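(* Let $(e_i)$ be a normalized Schauder basis with property $(S')$. Then there exists a function $\phi_{(e_i)}:[1,\omega_1)\times[1,\omega_1)\to[1,\omega_1)$ such that whenever $X,Y$ are Banach spaces (not necessarily separable) and $A,B\in\mathfrak{NP}_{(e_i)}(X,Y)$ satisfy $\mathbf{NP}_{(e_i)}(A,X,Y)=\xi<\omega_1$ and $\mathbf{NP}_{(e_i)}(B,X,Y)=\zeta<\omega_1$, one has $\mathbf{NP}_{(e_i)}(A+B,X,Y)\leqslant\phi_{(e_i)}(\xi,\zeta)$.
   Context: ''Operator'' means bounded linear operator between Banach spaces; $B_X$ is the closed unit ball; $[1,\omega_1)$ is the set of nonzero countable ordinals. $(u_i)\lesssim_K(v_i)$ means $\|\sum a_iu_i\|\leqslant K\|\sum a_iv_i\|$ for all scalars. A tree $T$ on a set is a set of finite sequences (the empty sequence allowed) closed under initial segments. $T'$ is $T$ minus its maximal members; $T^0=T$, $T^{\xi+1}=(T^\xi)'$, $T^\xi=\bigcap_{\zeta<\xi}T^\zeta$ for limit $\xi$; $o(T)$ is the least ordinal $\xi$ with $T^\xi=\varnothing$, or $\infty$ (larger than all ordinals) if there is none. For a normalized Schauder basis $(e_i)$, $A:X\to Y$ and $K\geqslant1$, $T_{(e_i)}(A,X,Y,K)$ is the tree of finite sequences $(x_i)_{i=1}^n$ in $B_X$ with $(x_i)_{i=1}^n\lesssim_1(e_i)_{i=1}^n$ and $(e_i)_{i=1}^n\lesssim_K(Ax_i)_{i=1}^n$, and $\mathbf{NP}_{(e_i)}(A,X,Y)=\sup_{K\geqslant1}o(T_{(e_i)}(A,X,Y,K))$.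 $\mathfrak{NP}_{(e_i)}(X,Y)$ is the set of operators $A:X\to Y$ not preserving a copy of $(e_i)$, i.e. for which there is no subspace $Z$ of $X$ isomorphic to the closed span $[e_i]$ with $A|_Z$ an isomorphic embedding; equivalently, $\mathbf{NP}_{(e_i)}(A,X,Y)<\infty$. $\mathfrak{NP}_{(e_i)}$ is the class of all such operators over all Banach spaces $X,Y$. The basis $(e_i)$ has property $(S')$ if $\mathfrak{NP}_{(e_i)}$ is an operator ideal. *)

(* Defs.v *)
From HB Require Import structures.
From mathcomp Require Import all_boot all_order all_algebra.
From mathcomp Require Import all_classical all_reals all_analysis.
From mathcomp.real_closed Require Import complex.

Set Implicit Arguments.
Unset Strict Implicit.
Unset Printing Implicit Defensive.

Import Order.TTheory GRing.Theory Num.Theory.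
Import numFieldNormedType.Exports.

Local Open Scope classical_set_scope.
Local Open Scope ring_scope.

(* Codes for ordinals: [osup f] denotes the supremum of the ordinals
   [f i + 1], so the empty family codes 0. *)
Inductive otree : Type := osup (I : Type) (f : I -> otree).

Fixpoint ole (a b : otree) {struct a} : Prop :=
  match a, b with osup U f, osup V g => forall i, exists j, ole (f i) (g j) end.

Definition olt (a b : otree) : Prop :=
  match b with osup V g => exists j, ole a (g j) end.

Definition oequiv (a b : otree) : Prop := ole a b /\ ole b a.

Lemma ole_refl a : ole a a.
Proof. by elim: a => U f IH /= i; exists i; exact: IH. Qed.

Lemma ole_trans b a c : ole a b -> ole b c -> ole a c.
Proof.
elim: a b c => U f IH [V g] [W h] /= ab bc i.
have [j fg] := ab i; have [l gh] := bc j.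
by exists l; exact: IH fg gh.
Qed.

Lemma oequiv_refl a : oequiv a a.
Proof. by split; exact: ole_refl. Qed.

Lemma olt_ole_trans b a c : olt a b -> ole b c -> olt a c.
Proof.
case: b c => [V g] [W h] /= [j ab] bc; have [l gh] := bc j.
by exists l; exact: ole_trans gh.
Qed.

Lemma ole_olt_trans b a c : ole a b -> olt b c -> olt a c.
Proof. by case: c => [W h] /= ab [l bl]; exists l; exact: ole_trans bl. Qed.

Lemma oltW a b : olt a b -> ole a b.
Proof.
elim: a b => U f IH [V g] /= [j H] i; exists j.
apply: IH; apply: (@olt_ole_trans (osup f)) H; exists i; exact: ole_refl.
Qed.

Lemma oleNlt a b : ~ ole a b -> olt b a.
Proof.
elim: a b => U f IH [V g] /= /existsNP[i Hi]; exists i.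
case: (f i) (IH i) Hi => L h IHi Hi /= j.
by apply: (IHi (g j)) => H; apply: Hi; exists j.
Qed.

Lemma olt_wf : well_founded olt.
Proof.
suff H a b : ole b a -> Acc olt b by move=> a; exact: H (ole_refl a).
elim: a b => U f IH b ba; constructor => c cb.
by have /= [i ci] := olt_ole_trans cb ba; exact: IH ci.
Qed.

Lemma olt_irr a : ~ olt a a.
Proof. by elim/(well_founded_ind olt_wf): a => a IH aa; exact: (IH a aa). Qed.

Definition canon (a : otree) : otree :=
  projT1 (cid (ex_intro (oequiv a) a (oequiv_refl a))).

Lemma canonP a : oequiv a (canon a).
Proof. by rewrite /canon; case: cid. Qed.

Lemma canon_eq a b : oequiv a b -> canon a = canon b.
Proof.
have cidE (P Q : otree -> Prop) (p : exists x, P x) (q : exists x, Q x) :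
    P = Q -> projT1 (cid p) = projT1 (cid q).
  by move=> PQ; case: Q / PQ q => q; rewrite (Prop_irrelevance p q).
move=> [ab ba]; apply: cidE.
apply/funext => c; apply/propext; split=> -[h1 h2]; split.
- exact: ole_trans ba h1.
- exact: ole_trans h2 ab.
- exact: ole_trans ab h1.
- exact: ole_trans h2 ba.
Qed.

(* Canonical codes, so that Leibniz equality is equality of ordinals. *)
Record Ord := MkOrd { ocode : otree; _ : canon ocode = ocode }.

Lemma canonK a : canon (canon a) = canon a.
Proof. by apply/esym/canon_eq/canonP. Qed.

Definition ord_of (a : otree) : Ord := MkOrd (canonK a).

Definition ord_le (a b : Ord) : Prop := ole (ocode a) (ocode b).
Definition ord_lt (a b : Ord) : Prop := olt (ocode a) (ocode b).

Lemma ord_le_refl a : ord_le a a.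
Proof. exact: ole_refl. Qed.

Lemma ord_le_trans b a c : ord_le a b -> ord_le b c -> ord_le a c.
Proof. exact: ole_trans. Qed.

Lemma ord_le_anti a b : ord_le a b -> ord_le b a -> a = b.
Proof.
case: a b => [a ha] [b hb]; rewrite /ord_le /= => ab ba.
have e : a = b by rewrite -ha -hb; exact: canon_eq.
by case: b / e hb {ab ba} => hb; rewrite (Prop_irrelevance ha hb).
Qed.

Lemma ord_ltNge a b : ord_lt a b <-> ~ ord_le b a.
Proof.
split=> [ab ba|]; last exact: oleNlt.
exact: olt_irr (olt_ole_trans ab ba).
Qed.

Lemma ord_lt_wf : well_founded ord_lt.
Proof.
suff H c : Acc olt c -> forall a, ocode a = c -> Acc ord_lt a.
  by move=> a; exact: H (olt_wf _) a erefl.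
elim=> {}c _ IH a ac; constructor => b ba.
by apply: (IH (ocode b)) => //; rewrite -ac.
Qed.

Definition ord_zero : Ord := ord_of (osup (fun x : False => match x with end)).
Definition ord_succ (a : Ord) : Ord := ord_of (osup (fun _ : unit => ocode a)).
Definition ord_limit (a : Ord) : Prop :=
  a <> ord_zero /\ forall b, ord_lt b a -> ord_lt (ord_succ b) a.

Lemma ord_zero_le a : ord_le ord_zero a.
Proof.
rewrite /ord_le /=; set z := osup _.
apply: (ole_trans (proj2 (canonP z))).
by case: (ocode a) => U f [].
Qed.

Lemma ord_le_succ a b : ord_le (ord_succ a) b <-> ord_lt a b.
Proof.
rewrite /ord_le /ord_lt /=; set s := osup _; split=> [sb|ab].
  apply: (olt_ole_trans _ sb); apply: (olt_ole_trans _ (proj1 (canonP s))).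
  by exists tt; exact: ole_refl.
apply: (ole_trans (proj2 (canonP s))).
by case: (ocode b) ab => I f /= [i ai] _; exists i.
Qed.

Lemma ord_bounded (I : Type) (f : I -> Ord) :
  exists a, forall i, ord_lt (f i) a.
Proof.
exists (ord_of (osup (fun i => ocode (f i)))) => i; rewrite /ord_lt /=.
apply: (olt_ole_trans _ (proj1 (canonP _))).
by exists i; exact: ole_refl.
Qed.

(* Elements of [option Ord] are ordinals, or infinity for [None]. *)
Definition xord_le (x y : option Ord) : Prop :=
  match x, y with
  | Some a, Some b => ord_le a b
  | _, None => True
  | None, Some _ => False
  end.

Definition is_least (P : Ord -> Prop) (a : Ord) : Prop :=
  P a /\ forall b, P b -> ord_le a b.

Definition least (P : Ord -> Prop) : option Ord :=
  if pselect (exists a, is_least P a) is left h then Some (projT1 (cid h))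
  else None.

Lemma leastP (P : Ord -> Prop) (a : Ord) : least P = Some a <-> is_least P a.
Proof.
rewrite /least; case: pselect => [h|nh]; last first.
  by split=> // Pa; exfalso; apply: nh; exists a.
case: cid => b [/= Pb lb]; split=> [[<-]//|[Pa la]].
by congr Some; apply: ord_le_anti; [exact: lb|exact: la].
Qed.

Lemma least_None (P : Ord -> Prop) : least P = None <-> forall a, ~ P a.
Proof.
rewrite /least; case: pselect => [h|nh].
  by split=> // P0; exfalso; case: h => a [/P0].
split=> // _ a.
elim/(well_founded_ind ord_lt_wf): a => a IH Pa; apply: nh; exists a.
split=> // b Pb; apply: contrapT => nab.
by apply: (IH b) => //; exact/ord_ltNge.
Qed.

(* Spelled out because [countable] would put Ord in the universe of the MathComp
   structures, which is too small: orders of trees on a Banach space must exist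
   as ordinals. *)
Definition ord_countable (a : Ord) : Prop :=
  exists f : Ord -> nat,
    forall b c, ord_lt b a -> ord_lt c a -> f b = f c -> b = c.

(* The interval [1, omega_1) of nonzero countable ordinals. *)
Definition countable_ord : Type :=
  {a : Ord | ord_lt ord_zero a /\ ord_countable a}.

Section Trees.
Variable S : Type.
Implicit Types (T : set (seq S)) (s t : seq S).

Definition is_tree T : Prop := forall s t, T (s ++ t) -> T s.

Definition maximal_in T s : Prop := T s /\ forall t, T (s ++ t) -> t = [::].

Definition derived T : set (seq S) := T `\` maximal_in T.

(* Uniform form of the transfinite recursion: the a-th derivative is the
   intersection of T and of the (b+1)-st derivatives for b < a. The lemmas
   below give the usual clauses at zero, successors and limits. *)
Fixpoint code_derived T (a : otree) {struct a} : set (seq S) :=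
  match a with
  | osup U f => [set s | T s /\ forall i, derived (code_derived T (f i)) s]
  end.

Definition iter_derived T (a : Ord) : set (seq S) := code_derived T (ocode a).

(* o(T), with infinity for [None] *)
Definition tree_order T : option Ord :=
  least (fun a => iter_derived T a = set0).

Lemma code_derived_sub T a : code_derived T a `<=` T.
Proof. by case: a => U f s []. Qed.

Lemma code_derived_tree T a : is_tree T -> is_tree (code_derived T a).
Proof.
move=> trT; elim: a => U f IH s t /= [Tst H]; split; first exact: trT Tst.
move=> i; have [Hi nmax] := H i; have Hs := IH i _ _ Hi; split=> // -[_ smax].
apply: nmax; split=> // u; rewrite -catA => /smax.
by case: t {Tst H Hi Hs} => [|//] /=; rewrite ?cats0.
Qed.

Lemma derivedP T s : is_tree T ->
  derived T s <-> exists t, t <> [::] /\ T (s ++ t).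
Proof.
move=> trT; split=> [[Ts nm]|[t [t0 Tst]]]; last first.
  by split; [exact: trT Tst|move=> [_ /(_ _ Tst)]].
apply: contrapT => H; apply: nm; split=> // t Tst.
by apply: contrapT => t0; apply: H; exists t.
Qed.

Lemma derived_mono T1 T2 : is_tree T1 -> is_tree T2 -> T1 `<=` T2 ->
  derived T1 `<=` derived T2.
Proof.
move=> t1 t2 T12 s /(derivedP _ t1)[t [t0 /T12 Tst]].
by apply/(derivedP _ t2); exists t.
Qed.

Lemma code_derived_anti T a b : is_tree T -> ole a b ->
  code_derived T b `<=` code_derived T a.
Proof.
move=> trT; elim: a b => U f IH [V g] /= ab s [Ts H]; split=> // i.
have [j fg] := ab i; have := H j.
by apply: derived_mono; [exact: code_derived_tree..|exact: IH].
Qed.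

Lemma code_derived_equiv T a b : is_tree T -> oequiv a b ->
  code_derived T a = code_derived T b.
Proof.
by move=> trT [ab ba]; apply/seteqP; split; exact: code_derived_anti.
Qed.

Lemma iter_derived0 T : is_tree T -> iter_derived T ord_zero = T.
Proof.
move=> trT; rewrite /iter_derived /=.
rewrite -(code_derived_equiv trT (canonP _)) /=.
by apply/seteqP; split=> [s []//|s Ts]; split.
Qed.

Lemma iter_derivedS T a : is_tree T ->
  iter_derived T (ord_succ a) = derived (iter_derived T a).
Proof.
move=> trT; rewrite /iter_derived /=.
rewrite -(code_derived_equiv trT (canonP _)) /=.
apply/seteqP; split=> [s [_ /(_ tt)]//|s H]; split=> // .
by case: H => /code_derived_sub.
Qed.

Lemma iter_derived_limit T a : is_tree T -> ord_limit a ->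
  iter_derived T a = [set s | forall b, ord_lt b a -> iter_derived T b s].
Proof.
move=> trT [a0 alim]; apply/seteqP; split=> s.
  by move=> sa b ba; move: sa; apply: code_derived_anti => //; exact: oltW.
move=> H; rewrite /iter_derived.
have Hlt c : olt c (ocode a) -> derived (code_derived T c) s.
  move=> ca; pose b := ord_of c.
  have ba : ord_lt b a by exact: ole_olt_trans (proj2 (canonP c)) ca.
  have /= := H _ (alim _ ba); rewrite iter_derivedS// /iter_derived /=.
  by rewrite -(code_derived_equiv trT (canonP c)).
have Ts : T s.
  have z : ord_lt ord_zero a.
    apply/ord_ltNge => az; apply: a0.
    by apply: ord_le_anti => //; exact: ord_zero_le.
  by have := H _ z; rewrite iter_derived0.
case: (ocode a) Hlt => I f Hlt /=; split=> // i.
by apply: Hlt; exists i; exact: ole_refl.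
Qed.

(* There are codes large enough for all trees: the order of a well-founded tree
   is an ordinal. *)
Lemma tree_order_wf T : is_tree T ->
  well_founded (fun t s => T t /\ exists x, t = rcons s x) ->
  exists a, tree_order T = Some a.
Proof.
move=> trT wfT.
have rk s : exists a, ~ derived (code_derived T a) s.
  elim/(well_founded_ind wfT): s => s IH.
  have /choice[f Hf] : forall x : S, exists a, T (rcons s x) ->
      ~ derived (code_derived T a) (rcons s x).
    move=> x; have [Tx|nTx] := pselect (T (rcons s x)).
      by have [|a Ha] := IH (rcons s x); [split=> //; exists x|exists a].
    by exists (osup (fun x : False => match x with end)).
  exists (osup f) => /(derivedP _ (code_derived_tree trT))[[|x t] [//]] _.
  rewrite -cat_rcons => /(code_derived_tree trT)[Tx /(_ x)].
  exact: Hf.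
have [a Ha] := rk [::].
have : exists b, iter_derived T b = set0.
  exists (ord_succ (ord_of a)); rewrite /= iter_derivedS// /iter_derived /=.
  rewrite -(code_derived_equiv trT (canonP a)) -subset0 => s.
  move=> /(derivedP _ (code_derived_tree trT))[t [t0 H]]; apply: Ha.
  apply/(derivedP _ (code_derived_tree trT)); exists (s ++ t); split=> //.
  by case: s t t0 {H} => [|? ?] [].
rewrite /tree_order; case E : (least _) => [b|]; first by exists b.
by move/least_None : E => E [b /E].
Qed.

End Trees.

(* Banach spaces are taken over the real or over the complex numbers. *)
Variant real_or_complex : numFieldType -> Prop :=
  | Real_scalars (R : realType) : real_or_complex R
  | Complex_scalars (R : realType) : real_or_complex R[i].

Section Operators.
Variable K : numFieldType.
Implicit Types W X Y Z E : completeNormedModType K.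

Definition bounded_operator X Y (A : {linear X -> Y}) : Prop :=
  exists M : K, forall x, `|A x| <= M * `|x|.

Definition bounded_below_on X Y (A : {linear X -> Y}) (D : set X) : Prop :=
  exists2 c : K, 0 < c & forall x, D x -> c * `|x| <= `|A x|.

Definition finite_rank X Y (A : {linear X -> Y}) : Prop :=
  exists n (v : 'I_n -> Y),
    forall x, exists c : 'I_n -> K, A x = \sum_(i < n) c i *: v i.

Definition operator_class : Type :=
  forall X Y, {linear X -> Y} -> Prop.

Record operator_ideal (J : operator_class) : Prop := OperatorIdeal {
  ideal_bounded : forall X Y (A : {linear X -> Y}),
    J X Y A -> bounded_operator A;
  ideal_finite_rank : forall X Y (A : {linear X -> Y}),
    bounded_operator A -> finite_rank A -> J X Y A;
  ideal_add : forall X Y (A B : {linear X -> Y}),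
    J X Y A -> J X Y B -> J X Y (A \+ B);
  ideal_scale : forall X Y (a : K) (A : {linear X -> Y}),
    J X Y A -> J X Y (a \*: A);
  ideal_comp : forall W X Y Z
      (C : {linear W -> X}) (A : {linear X -> Y}) (B : {linear Y -> Z}),
    bounded_operator C -> J X Y A -> bounded_operator B ->
    J W Z (B \o (A \o C))
}.

Section Basis.
Variables (E : completeNormedModType K) (e : nat -> E).

Definition schauder_basis : Prop :=
  forall x : E, exists! a : nat -> K,
    series (fun i => a i *: e i) @ \oo --> x.

Definition normalized_schauder_basis : Prop :=
  schauder_basis /\ forall i, `|e i| = 1.

Definition closed_span : set E :=
  closure [set x | exists n (a : nat -> K), x = \sum_(i < n) a i *: e i].

(* For a basis (e_i) of E the closed span is E itself, so an isomorphism of it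
   onto a subspace Z of X is defined on E. *)
Definition preserves_copy X Y (A : {linear X -> Y}) : Prop :=
  exists (Z : set X) (j : {linear E -> X}),
    [/\ bounded_operator j, bounded_below_on j closed_span,
        j @` closed_span = Z & bounded_below_on A Z].

(* The class of operators not preserving a copy of (e_i). *)
Definition NP_class : operator_class := fun X Y A =>
  bounded_operator A /\ ~ preserves_copy A.

Definition property_S' : Prop := operator_ideal NP_class.

(* (u_i)_(i < n) is C-dominated by (v_i)_(i < n) *)
Definition dominated (C : K) (U V : completeNormedModType K) (n : nat)
    (u : nat -> U) (v : nat -> V) : Prop :=
  forall a : nat -> K,
    `|\sum_(i < n) a i *: u i| <= C * `|\sum_(i < n) a i *: v i|.

Definition NP_tree X Y (A : {linear X -> Y}) (C : K) : set (seq X) :=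
  [set s | [/\ forall i, (i < size s)%N -> `|s`_i| <= 1,
               dominated 1 (size s) (fun i => s`_i) e &
               dominated C (size s) e (fun i => A s`_i)]].

(* The supremum over C >= 1 of o(NP_tree A C), as a least upper bound. *)
Definition NP_index X Y (A : {linear X -> Y}) : option Ord :=
  least (fun a => forall C : K, 1 <= C ->
                   xord_le (tree_order (NP_tree A C)) (Some a)).

Lemma NP_tree_is_tree X Y (A : {linear X -> Y}) C : is_tree (NP_tree A C).
Proof.
have sumE (U : completeNormedModType K) (F : nat -> U) m n (a : nat -> K) :
    \sum_(i < m + n) (if (i < m)%N then a i else 0) *: F i =
    \sum_(i < m) a i *: F i.
  rewrite big_split_ord /= [X in _ + X]big1 ?addr0.
    by apply: eq_bigr => i _; rewrite ltn_ord.
  by move=> i _; rewrite ltnNge leq_addr scale0r.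
move=> s t [sB d1 d2].
have catE (V : completeNormedModType K) (f : X -> V) (a : nat -> K) :
    \sum_(i < size s) a i *: f (s ++ t)`_i = \sum_(i < size s) a i *: f s`_i.
  by apply: eq_bigr => i _; rewrite nth_cat ltn_ord.
split=> [i is_|a|a].
- by have := sB i; rewrite nth_cat is_ size_cat ltn_addr //; exact.
- have := d1 (fun i => if (i < size s)%N then a i else 0).
  by rewrite size_cat !sumE; have /= -> := catE X id a.
- have := d2 (fun i => if (i < size s)%N then a i else 0).
  rewrite size_cat sumE (sumE Y (fun i => A (s ++ t)`_i)).
  by have /= -> := catE Y A a.
Qed.

End Basis.
End Operators.

(* Main.v *)
Require Import Defs.
From HB Require Import structures.
From mathcomp Require Import all_boot all_order all_algebra.
From mathcomp Require Import all_classical all_reals all_analysis.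
From mathcomp.real_closed Require Import complex.
From mathcomp Require Import ring.

(** Fix countable ordinals xi and zeta and look at all pairs (A, B) of operators
    of norm at most M with NP indices xi and zeta. If the trees of the sums
    A + B had unbounded countable orders, the boundedness theorem for analytic sets
    would produce a pair of operators that preserve no copy of (e_i) while
    their sum does, against property (S'). The argument is made concrete here with
    codes that record ranks only, not the norms of the spaces.

    That A has index at most xi is witnessed by rank functions: for every integer
    m, a map rho_m from finite sequences to natural numbers whose decoded ordinal
    value drops along every proper extension inside the tree of A with constant
    m + 1 ([countable_ranking]). Given (A, B), rank functions for both, and a node
    s = (x_1, ..., x_n) of the tree of A + B with constant M, record a sequence of
    n natural numbers: its i-th entry is the rank of one finite tuple of linear
    combinations of x_1, ..., x_(i+1) with coefficients in a countable dense set,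
    the tuples being enumerated so that each is visited infinitely often. The
    codes so obtained form a tree on the natural numbers, and s |-> code(s) maps
    the tree of A + B into it, strictly along extensions. Hence if the
    tree of codes is well founded, the tree of A + B has at most its order
    ([order_le_codes]), a countable ordinal that depends only on xi, zeta and M
    ([wf_tree_countable]). Any countable ordinal above these for all M is the
    required bound.

    Suppose the tree of codes has an infinite branch. Its n-th segment is realized
    by operators A_n, B_n : X_n -> Y_n and a node s_n of length n, and e_i |-> s_n(i)
    induces, through the basis projection onto the first n coordinates, a
    map L_n : E -> X_n. Take the ultralimit of A_n L_n and B_n L_n
    ([ultralimit_operator]): a Banach space F and operators S, T : E -> F with
    |S u + T v| = lim |A_n L_n u + B_n L_n v|. Each s_n is a node of the tree of
    A_n + B_n with the same constant M, so S + T is bounded below on E and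
    preserves a copy of the basis. By (S'), S or T, say S, preserves a copy
    of the basis. Perturb the image basis of this copy to vectors w_i with
    finitely many coordinates, all in the dense set ([perturb_copy]); here the
    basis constant of (e_i) is used ([basis_constant]). By
    compactness of finite-dimensional spheres ([ultra_bounded_below]), for every k
    and almost every n the tuple (L_n w_1, ..., L_n w_k) lies in the tree of A_n
    with a constant independent of k and n. The ranks of these tuples are entries
    of the branch, so they do not depend on n, and they decrease
    with k: an infinite decreasing sequence of ordinals. *)

Set Implicit Arguments.
Unset Strict Implicit.
Unset Printing Implicit Defensive.

Import Order.TTheory GRing.Theory Num.Theory.
Import numFieldNormedType.Exports.

Local Open Scope classical_set_scope.
Local Open Scope ring_scope.

(** * Countable ordinals and orders of trees *)

Lemma ord_le_lt_or_eq a b : ord_le a b -> a = b \/ ord_lt a b.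
Proof.
move=> ab; have [ba|nba] := pselect (ord_le b a); first by left; exact: ord_le_anti.
by right; exact/ord_ltNge.
Qed.

(** An ordinal below the strict supremum of the [c i] is below or equal to some
    [c i]; it is numbered by such an index together with its number below that
    [c i], the number 0 being reserved for [c i] itself. *)
Lemma ord_countable_sup (c : nat -> Ord) : (forall i, ord_countable (c i)) ->
  exists a, ord_countable a /\ forall i, ord_lt (c i) a.
Proof.
move=> /choice[f Hf]; exists (ord_of (osup (fun i => ocode (c i)))); split; last first.
  move=> i; rewrite /ord_lt /=; apply: (olt_ole_trans _ (proj1 (canonP _))).
  by exists i; exact: ole_refl.
have below b : ord_lt b (ord_of (osup (fun i => ocode (c i)))) ->
    exists i, ord_le b (c i).
  by move=> ba; have /= [l] := olt_ole_trans ba (proj2 (canonP _)); exists l.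
pose ix b := if pselect (exists i, ord_le b (c i)) is left h then projT1 (cid h)
             else 0%N.
have ixP b : (exists i, ord_le b (c i)) -> ord_le b (c (ix b)).
  by rewrite /ix; case: pselect => // h _; case: cid.
pose g b := pickle (ix b, if pselect (b = c (ix b)) then 0%N else (f (ix b) b).+1).
exists g => b b' /below/ixP bi /below/ixP b'i /(pcan_inj pickleK)[ei].
rewrite -ei in b'i *.
case: pselect => [eb|nb]; case: pselect => [eb'|nb'] //=; first by rewrite eb eb'.
move=> -[].
have below_ix x : ord_le x (c (ix b)) -> x <> c (ix b) -> ord_lt x (c (ix b)).
  by case/ord_le_lt_or_eq.
by apply: Hf; exact: below_ix.
Qed.

Section TreeOrders.
Variable S : Type.
Implicit Types (T : set (seq S)) (s t : seq S).

Lemma iter_derived_lt T a b : is_tree T -> ord_lt a b ->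
  iter_derived T b `<=` derived (iter_derived T a).
Proof.
move=> trT; rewrite /ord_lt /iter_derived; case: (ocode b) => U f /= [j aj] s.
move=> [_ /(_ j)]; apply: derived_mono; try exact: code_derived_tree.
exact: code_derived_anti.
Qed.

Lemma not_iter_derived T a s : is_tree T -> T s -> ~ iter_derived T a s ->
  exists2 b, ord_lt b a & ~ derived (iter_derived T b) s.
Proof.
move=> trT Ts; rewrite /iter_derived /ord_lt; case: (ocode a) => U f /= nTa.
have /existsNP[i Hi] : ~ forall i, derived (code_derived T (f i)) s.
  by move=> H; apply: nTa.
exists (ord_of (f i)); first by exists i; exact: (proj2 (canonP _)).
by rewrite /= -(code_derived_equiv trT (canonP (f i))).
Qed.

Lemma tree_orderP T a : tree_order T = Some a -> iter_derived T a = set0.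
Proof. by case/leastP. Qed.

Lemma tree_order_le T a : is_tree T ->
  xord_le (tree_order T) (Some a) <-> iter_derived T a = set0.
Proof.
move=> trT; case E : (tree_order T) => [b|] /=; split => //.
- move=> ba; rewrite -subset0 -(tree_orderP E); exact: code_derived_anti.
- by move=> Ta; case/leastP : E => _; apply.
- by move=> Ta; move/least_None : E => /(_ _ Ta).
Qed.

(** The rank of a node is the least [b] for which it is maximal in, or missing
    from, the [b]-th derivative. A proper extension then misses the [b]-th
    derivative, so it was already maximal or missing at an earlier stage. *)
Lemma ranking_exists T xi : is_tree T -> iter_derived T xi = set0 ->
  exists rho : seq S -> Ord, forall s, T s ->
    ord_lt (rho s) xi /\
    forall t, t <> [::] -> T (s ++ t) -> ord_lt (rho (s ++ t)) (rho s).
Proof.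
move=> trT T0.
pose P s b := ~ derived (iter_derived T b) s.
have ex s : exists b, T s -> is_least (P s) b.
  have [Ts|nTs] := pselect (T s); last by exists xi.
  case E : (least (P s)) => [b|]; first by exists b => _; exact/leastP.
  have [|b _ Pb] := not_iter_derived (a := xi) trT Ts; first by rewrite T0.
  by move/least_None : E => /(_ _ Pb).
have [rho Hrho] := choice ex; exists rho => s Ts.
have [Ps ls] := Hrho s Ts; split.
  have [|b bxi Pb] := not_iter_derived (a := xi) trT Ts; first by rewrite T0.
  by exact: ole_olt_trans (ls _ Pb) bxi.
move=> t t0 Tst; have [|b brho Pb] := not_iter_derived (a := rho s) trT Tst.
  move=> H; apply: Ps; apply/derivedP; first exact: code_derived_tree.
  by exists t.
by have [_ lst] := Hrho _ Tst; exact: ole_olt_trans (lst _ Pb) brho.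
Qed.

(** A map of trees that sends proper extensions to proper extensions cannot
    decrease ranks; this is how orders of trees are compared below. *)
Lemma iter_derived_map (S' : Type) T (T' : set (seq S')) (phi : seq S -> seq S') :
  is_tree T -> is_tree T' -> (forall s, T s -> T' (phi s)) ->
  (forall s t, t <> [::] -> exists2 t', t' <> [::] & phi (s ++ t) = phi s ++ t') ->
  forall a s, iter_derived T a s -> iter_derived T' a (phi s).
Proof.
move=> trT trT' TT' phiE a; rewrite /iter_derived; elim: (ocode a) => U f IH s /=.
move=> [Ts H]; split; first exact: TT'.
move=> i; have /derivedP[|t [t0 Tst]] := H i; first exact: code_derived_tree.
have [t' t'0 e] := phiE s t t0.
apply/derivedP; first exact: code_derived_tree.
by exists t'; split=> //; rewrite -e; exact: IH.
Qed.

End TreeOrders.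

(** Since [xi] is countable, the ranks can be given as natural numbers. The decoder
    [d] depends on [xi] alone, so that equal numbers mean equal ranks across
    different trees. *)
Lemma countable_ranking xi : ord_countable xi -> exists d : nat -> Ord,
  forall (S : Type) (T : set (seq S)), is_tree T -> iter_derived T xi = set0 ->
  exists rho : seq S -> nat, forall s t, t <> [::] -> T (s ++ t) ->
    ord_lt (d (rho (s ++ t))) (d (rho s)).
Proof.
move=> [f finj].
have [d Hd] : exists d : nat -> Ord, forall b, ord_lt b xi -> d (f b) = b.
  have /choice[d Hd] : forall n, exists b, forall c, ord_lt c xi -> f c = n -> c = b.
    move=> n; have [[b [bxi bn]]|nb] := pselect (exists b, ord_lt b xi /\ f b = n).
      by exists b => c cxi cn; apply: finj => //; rewrite cn.
    by exists xi => c cxi cn; case: nb; exists c.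
  by exists d => b bxi; rewrite -(Hd (f b) b).
exists d => S T trT T0; have [rho Hrho] := ranking_exists trT T0.
exists (f \o rho) => s t t0 Tst; have Ts := trT _ _ Tst.
have [sxi dec] := Hrho s Ts; have [stxi _] := Hrho _ Tst.
by rewrite /= !Hd//; exact: dec.
Qed.

(** A node has countably many children, so by induction along the well-founded
    tree its rank is a countable supremum of countable ordinals. *)
Lemma wf_tree_countable (T : set (seq nat)) : is_tree T ->
  (forall b : nat -> nat, ~ forall n, T (mkseq b n)) ->
  exists2 a, ord_countable a & iter_derived T a = set0.
Proof.
move=> trT nobranch.
pose R t s := T t /\ exists x, t = rcons s x.
have accN : Acc R [::].
  apply: contrapT => nacc.
  have /choice[g Hg] : forall s, exists x, ~ Acc R s ->
      T (rcons s x) /\ ~ Acc R (rcons s x).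
    move=> s; have [?|nas] := pselect (Acc R s); first by exists 0%N.
    apply: contrapT => H; apply: nas; constructor => t [Tt [x tx]].
    apply: contrapT => nt; apply: H; exists x => _; by rewrite -tx.
  pose sq := fix sq n := if n is m.+1 then rcons (sq m) (g (sq m)) else [::].
  have nsq n : ~ Acc R (sq n) by elim: n => //= n IH; case: (Hg _ IH).
  have Tsq n : T (sq n).
    case: n => [|n]; last by case: (Hg _ (nsq n)).
    by apply: (trT [::] [:: g [::]]); case: (Hg _ nacc).
  apply: (nobranch (g \o sq)) => n.
  suff -> : mkseq (g \o sq) n = sq n by [].
  by elim: n => //= n IH; rewrite mkseqS IH.
have [a ac Ha] : exists2 a, ord_countable a & ~ derived (iter_derived T a) [::].
  elim: accN => s _ IH.
  have /choice[f Hf] : forall x : nat, exists a, ord_countable a /\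
      (T (rcons s x) -> ~ derived (iter_derived T a) (rcons s x)).
    move=> x; have [Tx|nTx] := pselect (T (rcons s x)).
      by have [|a ca Ha] := IH (rcons s x); [split=> //; exists x|exists a].
    exists ord_zero; split => //; exists (fun=> 0%N) => b c.
    by move=> /ord_ltNge; case; exact: ord_zero_le.
  have [a [ca la]] := ord_countable_sup (fun i => proj1 (Hf i)).
  exists a => // /derivedP[|[|x t] [//]]; first exact: code_derived_tree.
  move=> _; rewrite -cat_rcons => /(code_derived_tree trT) Hx.
  apply: (proj2 (Hf x)); first exact: code_derived_sub Hx.
  exact: iter_derived_lt Hx.
have [b [cb /(_ 0%N) ab]] := ord_countable_sup (fun=> ac).
exists b => //; rewrite -subset0 => s /(iter_derived_lt trT ab) Hs; apply: Ha.
move: Hs => /derivedP[|t [t0 H]]; first exact: code_derived_tree.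
apply/derivedP; first exact: code_derived_tree.
by exists (s ++ t); split=> //; case: s t t0 {H} => [|? ?] [].
Qed.

(** * Real and complex scalars *)

Section Scalars.

(** Closed intervals are compact, hence an ultrafilter on one of them converges. *)
Lemma ultra_bounded_cvg_real (R : realType) (U : set_system nat) (f : nat -> R) (M : R) :
  UltraFilter U -> (forall n, `|f n| <= M) -> exists l : R, f @ U --> l.
Proof.
move=> UU fM; have UF : UltraFilter (f @ U).
  split; first exact: fmap_proper_filter.
  move=> G GG fG; apply/seteqP; split=> // A GA.
  have [//|nA] := in_ultra_setVsetC (f @^-1` A) UU.
  have /fG GnA : (f @ U) (~` A) by [].
  have /filter_ex[x [xA /(_ xA)]] : G (A `&` ~` A) by exact: filterI.
  by [].
have := @segment_compact R (- M) M; rewrite compact_ultra => /(_ (f @ U) UF) H.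
have [|l [_ fl]] := H; last by exists l.
apply: (@filterS _ U _ setT) (@filterT _ U _) => n _ /=.
by rewrite in_itv /= -ler_norml.
Qed.

Lemma complex_norm_lt (R : realType) (a b e : R) :
  `|a| < e / 2 -> `|b| < e / 2 -> `|(a +i* b)%C| < e%:C%C.
Proof.
move=> ae be; rewrite normc_def ltcR /= (le_lt_trans (y := `|a| + `|b|))//.
  rewrite -[leRHS]ger0_norm ?addr_ge0// -sqrtr_sqr ler_wsqrtr//.
  by rewrite sqrrD !real_normK ?num_real// addrAC lerDl mulrn_wge0// mulr_ge0.
by rewrite [ltRHS]splitr ltrD.
Qed.

Lemma scalars_archimedean (K : numFieldType) (hK : real_or_complex K) (x : K) :
  exists n : nat, `|x| <= n%:R.
Proof.
case: K / hK x => R x; first by exists (Num.truncn `|x|).+1; rewrite ltW// truncnS_gt.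
exists (Num.truncn (Normc.normc x)).+1.
rewrite -[leLHS]/((Normc.normc x)%:C%C) -(rmorph_nat (@real_complex R)) lecR ltW//.
exact: truncnS_gt.
Qed.

Lemma scalars_dense_sequence (K : numFieldType) (hK : real_or_complex K) :
  exists d : nat -> K, forall (x e : K), 0 < e -> exists n, `|x - d n| < e.
Proof.
have real (R : realType) (x e : R) : 0 < e -> exists q : rat, `|x - ratr q| < e.
  move=> e0; have [|q] := @rat_in_itvoo R (x - e) (x + e).
    by rewrite ltrBlDr -addrA ltrDl addr_gt0.
  by rewrite in_itv /= -ltr_distlC distrC => H; exists q; rewrite distrC.
case: K / hK => R.
  exists (fun n => ratr (odflt 0 (unpickle n : option rat))) => x e /(real _ x)[q Hq].
  by exists (pickle q); rewrite pickleK.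
exists (fun n => let p := odflt (0, 0) (unpickle n : option (rat * rat)%type) in
                 (ratr p.1 +i* ratr p.2)%C) => -[a b] [e e'].
rewrite ltcE /= => /andP[/eqP-> e0].
have e20 : 0 < e / 2 by rewrite divr_gt0.
have [p Hp] := real _ a _ e20; have [q Hq] := real _ b _ e20.
exists (pickle (p, q)); rewrite pickleK /=.
exact: complex_norm_lt.
Qed.

Lemma ultra_bounded_cvg (K : numFieldType) (hK : real_or_complex K)
    (U : set_system nat) (f : nat -> K) (M : K) :
  UltraFilter U -> (forall n, `|f n| <= M) -> exists l : K, f @ U --> l.
Proof.
move=> UU; case: K / hK f M => R f M fM.
  exact: ultra_bounded_cvg_real fM.
have nfM n : Normc.normc (f n) <= complex.Re M.
  by have := fM n; rewrite lecE /= => /andP[_].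
have [|a fa] := @ultra_bounded_cvg_real R U (fun n => complex.Re (f n)) (complex.Re M) UU.
  move=> n; apply: le_trans (nfM n); rewrite -lecR; exact: normc_ge_Re.
have [|b fb] := @ultra_bounded_cvg_real R U (fun n => complex.Im (f n)) (complex.Re M) UU.
  move=> n; apply: le_trans (nfM n); case: (f n) => x y /=.
  by rewrite -sqrtr_sqr ler_wsqrtr// lerDr sqr_ge0.
exists (a +i* b)%C; apply/cvgrPdist_lt => -[e e'].
rewrite ltcE /= => /andP[/eqP-> e0].
have e20 : 0 < e / 2 by rewrite divr_gt0.
move/cvgrPdist_lt : fa => /(_ _ e20) fa.
move/cvgrPdist_lt : fb => /(_ _ e20) fb.
near=> n.
have -> : (a +i* b)%C - f n = ((a - complex.Re (f n)) +i* (b - complex.Im (f n)))%C.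
  by case: (f n).
apply: complex_norm_lt.
- by near: n.
- by near: n.
Unshelve. all: by end_near. Qed.

End Scalars.

(** * Limits of scalar sequences *)

Section Limits.
Variable K : numFieldType.

(** The order of [K] is only partial when the scalars are complex, but a limit of
    nonnegative scalars equals its own norm. *)
Lemma cvg_ge0 (T : Type) (F : set_system T) (f : T -> K) (l : K) :
  ProperFilter F -> f @ F --> l -> (\forall t \near F, 0 <= f t) -> 0 <= l.
Proof.
move=> FF fl f0; suff -> : l = `|l| by [].
have nl : (fun t => `|f t|) @ F --> `|l| by exact: cvg_norm.
apply: (@norm_cvg_unique _ _ (f @ F) _ l `|l|) => //.
apply: cvg_trans nl; apply: near_eq_cvg; near=> t.
by rewrite ger0_norm//; near: t.
Unshelve. all: by end_near. Qed.

Lemma cvg_le_le (T : Type) (F : set_system T) (f g : T -> K) (l m : K) :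
  ProperFilter F -> f @ F --> l -> g @ F --> m ->
  (\forall t \near F, f t <= g t) -> l <= m.
Proof.
move=> FF fl gm fg; rewrite -subr_ge0.
apply: (@cvg_ge0 _ F (g \- f)); first exact: cvgB.
by near=> t; rewrite /= subr_ge0; near: t.
Unshelve. all: by end_near. Qed.

Hypothesis hK : real_or_complex K.

Lemma nat_ultrafilter : exists U : set_system nat, UltraFilter U /\ \oo `<=` U.
Proof. exact: ultraFilterLemma. Qed.

Lemma inv_succ_lt (e : K) : 0 < e -> exists n : nat, n.+1%:R^-1 < e.
Proof.
move=> e0; have [n Hn] := scalars_archimedean hK e^-1.
exists n; rewrite -[ltRHS]invrK ltf_pV2 ?posrE ?invr_gt0 ?ltr0n//.
rewrite ger0_norm in Hn; last by rewrite invr_ge0 ltW.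
by rewrite (le_lt_trans Hn)// ltr_nat.
Qed.

Definition is_cauchy_seq (V : zmodType) (q : V -> K) (u : nat -> V) : Prop :=
  forall e : K, 0 < e ->
    exists N, forall m n, (N <= m)%N -> (N <= n)%N -> q (u m - u n) < e.

(** A Cauchy sequence is bounded, and it converges to its limit along any
    ultrafilter finer than the cofinite one. *)
Lemma scalars_cauchy_cvg (f : nat -> K) :
  is_cauchy_seq Num.norm f -> exists l : K, f @ \oo --> l.
Proof.
move=> cf; have [U [UU oU]] := nat_ultrafilter.
have [N HN] := cf _ ltr01.
have [|l fl] := @ultra_bounded_cvg K hK U (fun n => f (N + n)%N) (1 + `|f N|) UU.
  move=> n; rewrite -lerBlDr; apply: (le_trans (lerB_dist _ _)).
  by rewrite ltW// HN// leq_addr.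
exists l; apply/cvgrPdist_lt => e e0.
have e20 : 0 < e / 2 by rewrite divr_gt0.
have [M HM] := cf _ e20.
exists M => // n /= Mn.
move/cvgrPdist_lt : fl => /(_ _ e20) fl.
have /oU UM : \oo [set k | (M <= k)%N] by exists M.
have [k [/= lk Mk]] := filter_ex (filterI fl UM).
rewrite -(subrKA (f (N + k)%N)) (le_lt_trans (ler_normD _ _))//.
by rewrite [ltRHS]splitr ltrD// HM// (leq_trans Mk)// leq_addl.
Qed.

End Limits.

(** * Completion of a seminormed space *)

Record seminorm (K : numFieldType) (V : lmodType K) := Seminorm {
  semi :> V -> K;
  semi_ge0 : forall x, 0 <= semi x;
  semiD : forall x y, semi (x + y) <= semi x + semi y;
  semiZ : forall a x, semi (a *: x) = `|a| * semi x }.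

Section SeminormTheory.
Local Open Scope quotient_scope.
Variables (K : numFieldType) (V : lmodType K) (q : seminorm V).

Lemma semi0 : q 0 = 0.
Proof. by rewrite -(scale0r 0) semiZ normr0 mul0r. Qed.

Lemma semiN x : q (- x) = q x.
Proof. by rewrite -scaleN1r semiZ normrN1 mul1r. Qed.

Lemma semiB x y : q (x - y) = q (y - x).
Proof. by rewrite -semiN opprB. Qed.

Lemma semi_dist x y : `|q x - q y| <= q (x - y).
Proof.
have le u v : q u - q v <= q (u - v) by rewrite lerBlDr -{1}(subrK v u) semiD.
by rewrite real_ler_norml ?rpredB ?ger0_real ?semi_ge0// lerNl opprB le semiB le.
Qed.

Definition semi_ker : {pred V} := fun x => `[< q x = 0 >].

Lemma semi_kerP x : reflect (q x = 0) (x \in semi_ker).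
Proof. exact: asboolP. Qed.

Lemma semi_ker_zmod : zmod_closed semi_ker.
Proof.
split=> [|x y /semi_kerP qx /semi_kerP qy]; apply/semi_kerP; first exact: semi0.
apply/eqP; rewrite eq_le semi_ge0 andbT (le_trans (semiD _ _ _))//.
by rewrite semiN qx qy addr0.
Qed.

HB.instance Definition _ := GRing.isZmodClosed.Build V semi_ker semi_ker_zmod.

(** The quotient of [V] by the kernel of [q], on which [q] becomes a norm. *)
Definition sep : Type := Quotient.quot semi_ker.
HB.instance Definition _ := GRing.Zmodule.on sep.

Definition sep_pi (x : V) : sep := \pi_(Quotient.quot semi_ker) x.
Definition sep_repr (x : sep) : V := repr (x : Quotient.quot semi_ker).

Lemma sep_reprK x : sep_pi (sep_repr x) = x.
Proof. exact: reprK. Qed.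

Lemma sep_pi_eq x y : q (x - y) = 0 <-> sep_pi x = sep_pi y.
Proof.
split=> [H|/eqP]; first by apply/eqP; rewrite -Quotient.idealrBE; exact/semi_kerP.
by rewrite -Quotient.idealrBE => /semi_kerP.
Qed.

Lemma sep_piD x y : sep_pi (x + y) = sep_pi x + sep_pi y.
Proof. exact: raddfD. Qed.

Definition sep_scale (a : K) (x : sep) : sep := sep_pi (a *: sep_repr x).

Lemma sep_piZ a x : sep_pi (a *: x) = sep_scale a (sep_pi x).
Proof.
apply/sep_pi_eq; rewrite -scalerBr semiZ.
have /sep_pi_eq -> : sep_pi x = sep_pi (sep_repr (sep_pi x)) by rewrite sep_reprK.
by rewrite mulr0.
Qed.

Lemma sep_scalerA a b v : sep_scale a (sep_scale b v) = sep_scale (a * b) v.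
Proof. by rewrite -(sep_reprK v) -!sep_piZ scalerA. Qed.
Lemma sep_scale1r : left_id 1 sep_scale.
Proof. by move=> v; rewrite -(sep_reprK v) -!sep_piZ scale1r. Qed.
Lemma sep_scalerDr : right_distributive sep_scale +%R.
Proof.
move=> a u v; rewrite -(sep_reprK v) -(sep_reprK u).
by rewrite -sep_piD -!sep_piZ scalerDr sep_piD.
Qed.
Lemma sep_scalerDl v : {morph sep_scale^~ v : a b / a + b}.
Proof. by move=> a b; rewrite -(sep_reprK v) -!sep_piZ scalerDl sep_piD. Qed.

HB.instance Definition _ := GRing.Zmodule_isLmodule.Build K sep
  sep_scalerA sep_scale1r sep_scalerDr sep_scalerDl.

Definition sep_norm (x : sep) : K := q (sep_repr x).

Lemma sep_norm_pi x : sep_norm (sep_pi x) = q x.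
Proof.
have /sep_pi_eq H : sep_pi (sep_repr (sep_pi x)) = sep_pi x by rewrite sep_reprK.
by apply/eqP; rewrite -subr_eq0 -normr_le0 -H semi_dist.
Qed.

Lemma sep_normD x y : sep_norm (x + y) <= sep_norm x + sep_norm y.
Proof. by rewrite -(sep_reprK x) -(sep_reprK y) -sep_piD !sep_norm_pi semiD. Qed.
Lemma sep_normZ a (x : sep) : sep_norm (a *: x) = `|a| * sep_norm x.
Proof.
rewrite -(sep_reprK x) -[_ *: _]/(sep_scale _ _) -sep_piZ !sep_norm_pi.
exact: semiZ.
Qed.
Lemma sep_norm0 (x : sep) : sep_norm x = 0 -> x = 0.
Proof.
move=> H; rewrite -(sep_reprK x) -[0](sep_reprK 0); apply/sep_pi_eq.
have r0 : q (sep_repr 0) = 0.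
  rewrite -/(sep_norm 0) (_ : 0 = sep_pi 0) ?sep_norm_pi ?semi0//.
  by rewrite /sep_pi raddf0.
apply/eqP; rewrite eq_le semi_ge0 andbT (le_trans (semiD _ _ _))//.
by rewrite semiN r0 addr0 -/(sep_norm x) H.
Qed.

HB.instance Definition _ := Lmodule_isNormed.Build K sep
  sep_normD sep_normZ sep_norm0.

Lemma norm_sep_pi x : `|sep_pi x| = q x.
Proof. exact: sep_norm_pi. Qed.

Lemma sep_pi_linear : linear sep_pi.
Proof. by move=> a x y; rewrite sep_piD sep_piZ. Qed.
HB.instance Definition _ := GRing.isLinear.Build K V sep _ sep_pi sep_pi_linear.

End SeminormTheory.

Section Completion.
Variables (K : numFieldType) (V : lmodType K) (q : seminorm V).

Definition cauchy_seqs : {pred (nat -> V)} := fun u => `[< is_cauchy_seq q u >].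

Lemma cauchy_seqsP u : reflect (is_cauchy_seq q u) (u \in cauchy_seqs).
Proof. exact: asboolP. Qed.

Lemma cauchy_seqs_submod : submod_closed cauchy_seqs.
Proof.
split=> [|a u v /cauchy_seqsP cu /cauchy_seqsP cv]; apply/cauchy_seqsP => e e0.
  by exists 0%N => m n _ _; rewrite subrr semi0.
have e20 : 0 < e / 2 by rewrite divr_gt0.
have a1 : 0 < `|a| + 1 by rewrite ltr_wpDl.
have [N HN] := cu _ (divr_gt0 e20 a1); have [M HM] := cv _ e20.
exists (maxn N M) => m n; rewrite !geq_max => /andP[Nm Mm] /andP[Nn Mn].
rewrite [X in q X](_ : _ = a *: (u m - u n) + (v m - v n)); last first.
  by rewrite !fctE scalerBr opprD addrACA.
rewrite (le_lt_trans (semiD _ _ _))// [ltRHS]splitr ltrD ?HM// semiZ.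
have := HN m n Nm Nn; rewrite ltr_pdivlMr// mulrC; apply: le_lt_trans.
by rewrite ler_wpM2r ?semi_ge0// lerDl.
Qed.

HB.instance Definition _ := GRing.isSubmodClosed.Build K (nat -> V) cauchy_seqs
  cauchy_seqs_submod.

Record cseq : Type := CSeq { cseq_val :> nat -> V; _ : cseq_val \in cauchy_seqs }.

HB.instance Definition _ := [isSub for cseq_val].
HB.instance Definition _ := [Choice of cseq by <:].
HB.instance Definition _ := [SubChoice_isSubLmodule of cseq by <:].

Lemma cseqP (u : cseq) : is_cauchy_seq q u.
Proof. by apply/cauchy_seqsP; case: u. Qed.

Variable hK : real_or_complex K.

Lemma cseq_norm_cvg (u : cseq) : exists l : K, q \o u @ \oo --> l.
Proof.
apply: (scalars_cauchy_cvg hK) => e /(cseqP u)[N HN].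
by exists N => m n Nm Nn; rewrite (le_lt_trans (semi_dist _ _ _))// HN.
Qed.

Definition cseq_norm (u : cseq) : K := projT1 (cid (cseq_norm_cvg u)).

Lemma cseq_normP (u : cseq) : q \o u @ \oo --> cseq_norm u.
Proof. by rewrite /cseq_norm; case: cid. Qed.

Lemma cseq_norm_ge0 u : 0 <= cseq_norm u.
Proof.
by apply: (cvg_ge0 _ (@cseq_normP u)); apply: nearW => n; exact: semi_ge0.
Qed.

Lemma cseq_normD u v : cseq_norm (u + v) <= cseq_norm u + cseq_norm v.
Proof.
apply: (cvg_le_le _ (@cseq_normP (u + v)) (cvgD (@cseq_normP u) (@cseq_normP v))).
by apply: nearW => n; exact: semiD.
Qed.

Lemma cseq_normZ a u : cseq_norm (a *: u) = `|a| * cseq_norm u.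
Proof.
apply: (@norm_cvg_unique _ _ (q \o (a *: u) @ \oo)); first exact: (@cseq_normP _).
rewrite [X in X @ \oo](_ : _ = fun n => `|a| * (q \o u) n).
  by apply: cvgMr; exact: (@cseq_normP _).
by apply/funext => n; exact: semiZ.
Qed.

Definition cseq_seminorm : seminorm cseq :=
  Seminorm cseq_norm_ge0 cseq_normD cseq_normZ.

(** Cauchy sequences modulo those of limit seminorm 0. *)
Definition completion : Type := sep cseq_seminorm.

HB.instance Definition _ := NormedModule.on completion.

Lemma const_cauchy (v : V) : (fun _ : nat => v) \in cauchy_seqs.
Proof. by apply/cauchy_seqsP => e e0; exists 0%N => *; rewrite subrr semi0. Qed.

Definition to_completion (v : V) : completion :=
  sep_pi cseq_seminorm (CSeq (const_cauchy v)).

Lemma to_completion_linear : linear to_completion.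
Proof.
move=> a x y; rewrite /to_completion -linearP; congr sep_pi; exact: val_inj.
Qed.
HB.instance Definition _ := GRing.isLinear.Build K V completion _ to_completion
  to_completion_linear.

Lemma norm_to_completion v : `|to_completion v| = q v.
Proof.
rewrite norm_sep_pi; apply: (@norm_cvg_unique _ _ (q \o (fun _ => v) @ \oo)).
  exact: (@cseq_normP (CSeq (const_cauchy v))).
exact: cvg_cst.
Qed.

Lemma to_completion_dense (x : completion) (e : K) : 0 < e ->
  exists v, `|x - to_completion v| < e.
Proof.
move=> e0; rewrite -(sep_reprK x); set u : cseq := sep_repr x.
have e20 : 0 < e / 2 by rewrite divr_gt0.
have [N HN] := cseqP u e20; exists (u N).
have -> : sep_pi cseq_seminorm u - to_completion (u N) =
    sep_pi cseq_seminorm (u - CSeq (const_cauchy (u N))) by rewrite linearB.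
rewrite norm_sep_pi (@le_lt_trans _ _ (e / 2))//; last first.
  by rewrite ltr_pdivrMr// mulr_natr mulr2n ltrDl.
apply: (cvg_le_le _ (@cseq_normP _) (cvg_cst (e / 2))).
by exists N => // n /= Nn; rewrite ltW// HN.
Qed.

(** Points of [V] are dense, so a Cauchy filter contains a ball of radius
    2 / (n + 1) around one of them for every [n]; these centres form a Cauchy
    sequence of [V], and its class is the limit. *)
Lemma completion_complete (F : set_system completion) :
  ProperFilter F -> cauchy F -> cvg F.
Proof.
move=> FF cF.
have dpos (n : nat) : 0 < n.+1%:R^-1 :> K by rewrite invr_gt0 ltr0n.
have /choice[v Hv] : forall n : nat, exists v : V,
    F (ball (to_completion v) (2 * n.+1%:R^-1)).
  move=> n; have /cauchyP/(_ _ (dpos n))[x Fx] := cF.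
  have [v xv] := to_completion_dense x (dpos n); exists v.
  apply: filterS Fx => y; rewrite -!ball_normE /= => xy.
  rewrite -(subrKA x) (le_lt_trans (ler_normD _ _))// mulr_natl mulr2n ltrD//.
  by rewrite distrC.
have close m n : q (v m - v n) < 2 * m.+1%:R^-1 + 2 * n.+1%:R^-1.
  have [y []] := filter_ex (filterI (Hv m) (Hv n)).
  rewrite -!ball_normE /= => my ny.
  rewrite -norm_to_completion linearB -(subrKA y) (le_lt_trans (ler_normD _ _))//.
  by rewrite ltrD// distrC.
have small (e : K) : 0 < e -> exists N, forall n, (N <= n)%N -> 2 * n.+1%:R^-1 < e.
  move=> e0; have [|N HN] := inv_succ_lt hK (e := e / 2); first by rewrite divr_gt0.
  exists N => n Nn; rewrite -ltr_pdivlMl// mulrC (le_lt_trans _ HN)//.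
  by rewrite lef_pV2 ?posrE ?ltr0n// ler_nat.
have cv : v \in cauchy_seqs.
  apply/cauchy_seqsP => e e0; have [|N HN] := small (e / 2); first by rewrite divr_gt0.
  exists N => m n Nm Nn; rewrite (lt_trans (close m n))// [ltRHS]splitr ltrD//.
    exact: HN.
  exact: HN.
pose x : completion := sep_pi cseq_seminorm (CSeq cv).
apply/cvg_ex; exists x; apply/cvgrPdist_lt => e e0.
have [|N HN] := small (e / 2 / 2); first by rewrite !divr_gt0.
have xv : `|x - to_completion (v N)| <= e / 2.
  have -> : x - to_completion (v N) =
    sep_pi cseq_seminorm (CSeq cv - CSeq (const_cauchy (v N))) by rewrite linearB.
  rewrite norm_sep_pi; apply: (cvg_le_le _ (@cseq_normP _) (cvg_cst (e / 2))).
  exists N => // n /= Nn; rewrite ltW// (lt_trans (close _ _))//.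
  by rewrite [ltRHS]splitr ltrD// HN.
apply: filterS (Hv N) => y; rewrite -ball_normE /= => vy.
rewrite -(subrKA (to_completion (v N))) (le_lt_trans (ler_normD _ _))//.
rewrite [ltRHS]splitr ler_ltD// (lt_trans vy)// (lt_trans (HN N _))//.
by rewrite ltr_pdivrMr// mulr_natr mulr2n ltrDl divr_gt0.
Qed.

HB.instance Definition _ := Uniform_isComplete.Build completion completion_complete.

End Completion.

Lemma completion_exists (K : numFieldType) (hK : real_or_complex K)
    (V : lmodType K) (q : seminorm V) :
  exists (F : completeNormedModType K) (i : {linear V -> F}), forall v, `|i v| = q v.
Proof.
exists (completion q hK : completeNormedModType K).
exists (to_completion q hK : {linear _ -> _}).
exact: norm_to_completion.
Qed.

(** * Baire category in Banach spaces *)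

Lemma pos_lower_bound (K : numFieldType) (a b : K) : 0 < a -> 0 < b ->
  exists c, [/\ 0 < c, c <= a & c <= b].
Proof.
move=> a0 b0; have [ab|ba] := real_leP (gtr0_real a0) (gtr0_real b0).
  by exists a.
by exists b; split=> //; exact: ltW.
Qed.

Section BanachSequences.
Variables (K : numFieldType) (hK : real_or_complex K) (E : completeNormedModType K).

Lemma banach_cauchy_cvg (u : nat -> E) : is_cauchy_seq Num.norm u ->
  exists l : E, u @ \oo --> l.
Proof.
move=> cu; apply/cvg_ex; apply: cauchy_cvg; apply: cauchy_exP => e e0.
have [N HN] := cu _ e0; exists (u N), N => // n /= Nn.
by rewrite -ball_normE /= HN.
Qed.

Lemma cvg_norm_le (u : nat -> E) (l x : E) (M : K) :
  u @ \oo --> l -> (\forall n \near \oo, `|x - u n| <= M) -> `|x - l| <= M.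
Proof.
move=> ul H; apply: (@cvg_le_le K nat \oo (fun n => `|x - u n|) (fun=> M)) H.
- by apply: cvg_norm; apply: cvgB => //; exact: cvg_cst.
- exact: cvg_cst.
Qed.

(** If no [A m] were dense in a ball, closed balls could be nested so that the
    [m]-th one stays away from [A m], and their common point would escape the
    cover. *)
Lemma baire_cover (A : nat -> set E) : (forall x, exists m, A m x) ->
  exists m x r, 0 < r /\ forall y, `|y - x| < r ->
    forall d : K, 0 < d -> exists2 u, A m u & `|y - u| < d.
Proof.
move=> cover; apply: contrapT => no.
have step (m : nat) (p : E * {r : K | 0 < r}) : exists p' : E * {r : K | 0 < r},
    [/\ `|p'.1 - p.1| + sval p'.2 <= sval p.2, sval p'.2 <= m.+1%:R^-1 &
        forall u, A m u -> 2 * sval p'.2 <= `|p'.1 - u| ].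
  case: p => x [r r0] /=.
  have [y [d [xy d0 far]]] : exists y d, [/\ `|y - x| < r, 0 < d &
      forall u, A m u -> d <= `|y - u|].
    apply: contrapT => H; apply: no; exists m, x, r; split=> // y yx d d0.
    apply: contrapT => nu; apply: H; exists y, d; split=> // u Au.
    rewrite real_leNgt ?normr_real ?gtr0_real//; apply/negP => yu.
    by apply: nu; exists u.
  have [c [c0 cd cr]] : exists c, [/\ 0 < c, c <= d / 2 & c <= r - `|y - x|].
    by apply: pos_lower_bound; rewrite ?divr_gt0// subr_gt0.
  have [c' [c'0 c'c c'm]] : exists c', [/\ 0 < c', c' <= c & c' <= m.+1%:R^-1].
    by apply: pos_lower_bound => //; rewrite invr_gt0 ltr0n.
  exists (y, exist _ c' c'0); split=> //=.
    by rewrite addrC -lerBrDr (le_trans c'c).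
  move=> u /far; apply: le_trans; rewrite mulrC -ler_pdivlMr//.
  exact: le_trans cd.
have ex : forall mp : nat * (E * {r : K | 0 < r}), exists p' : E * {r : K | 0 < r},
    [/\ `|p'.1 - mp.2.1| + sval p'.2 <= sval mp.2.2, sval p'.2 <= mp.1.+1%:R^-1 &
        forall u, A mp.1 u -> 2 * sval p'.2 <= `|p'.1 - u| ].
  by move=> [m p]; exact: step.
have [f Hf] := choice ex.
pose sq := fix sq n := if n is m.+1 then f (m, sq m) else (0, exist _ 1 ltr01).
pose x n := (sq n).1; pose r n := sval (sq n).2.
have r0 n : 0 < r n by rewrite /r; case: (sq n).2.
have nest n m : (n <= m)%N -> `|x m - x n| + r m <= r n.
  elim: m => [|m IH]; first by rewrite leqn0 => /eqP->; rewrite subrr normr0 add0r.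
  rewrite leq_eqVlt => /orP[/eqP->|/IH H]; first by rewrite subrr normr0 add0r.
  have [H1 _ _] := Hf (m, sq m); apply: le_trans H.
  have T := ler_distD (x m) (x m.+1) (x n).
  by rewrite (le_trans (lerD T (lexx _)))// addrAC [leLHS]addrC lerD2l.
have dist n m : (n <= m)%N -> `|x m - x n| <= r n.
  by move=> /nest; apply: le_trans; rewrite lerDl ltW.
have cx : is_cauchy_seq Num.norm x.
  move=> d d0; have [|N HN] := inv_succ_lt hK (e := d / 2); first by rewrite divr_gt0.
  exists N.+1 => m n Nm Nn; have [_ rN _] := Hf (N, sq N).
  have lt : r N.+1 < d / 2 by exact: le_lt_trans rN HN.
  rewrite -(subrKA (x N.+1)) (le_lt_trans (ler_normD _ _))// [ltRHS]splitr.
  rewrite ltrD// (le_lt_trans _ lt)// ?dist// distrC dist//.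
have [l xl] := banach_cauchy_cvg cx.
have [m Aml] := cover l; have [_ _ /(_ l Aml) far] := Hf (m, sq m).
have : `|x m.+1 - l| <= r m.+1.
  apply: (cvg_norm_le xl); exists m.+1 => // n /= mn.
  by rewrite distrC dist.
move=> /(le_trans far); rewrite -/(r m.+1) mulr_natl mulr2n.
by rewrite -[leRHS]addr0 lerD2l => /(lt_le_trans (r0 _)); rewrite ltxx.
Qed.

End BanachSequences.

(** * The basis constant of a Schauder basis *)

Section Halves.
Variables (K : numFieldType) (hK : real_or_complex K).

Lemma half_pow_lt (e : K) : 0 < e ->
  exists n : nat, forall m, (n <= m)%N -> 2^-1 ^+ m < e.
Proof.
move=> e0; have [n Hn] := inv_succ_lt hK e0; exists n.+1 => m nm.
apply: le_lt_trans Hn; rewrite exprVn lef_pV2 ?posrE ?exprn_gt0// -natrX ler_nat.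
by rewrite (leq_trans nm)// ltnW// ltn_expl.
Qed.

End Halves.

Section Coefficients.
Variables (K : numFieldType) (E : completeNormedModType K) (e : nat -> E).
Hypothesis hb : schauder_basis e.

Definition coef (x : E) : nat -> K := projT1 (cid (hb x)).

Lemma coef_sum_cvg x : (fun n => \sum_(i < n) coef x i *: e i) @ \oo --> x.
Proof.
rewrite /coef; case: cid => a [/= H _].
rewrite [X in X @ \oo](_ : _ = series (fun i => a i *: e i))//.
by apply/funext => n; rewrite seriesEord.
Qed.

Lemma coef_unique x (a : nat -> K) :
  (fun n => \sum_(i < n) a i *: e i) @ \oo --> x -> coef x = a.
Proof.
rewrite /coef; case: cid => b [/= _ H] ax; apply: H.
rewrite [X in X @ \oo](_ : _ = (fun n => \sum_(i < n) a i *: e i))//.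
by apply/funext => n; rewrite seriesEord.
Qed.

Lemma coef_linear a x y i : coef (a *: x + y) i = a * coef x i + coef y i.
Proof.
rewrite (@coef_unique _ (fun i => a * coef x i + coef y i))//.
rewrite [X in X @ \oo](_ : _ = (fun n =>
    a *: (\sum_(i < n) coef x i *: e i) + \sum_(i < n) coef y i *: e i)).
  by apply: cvgD; [apply: cvgZl_tmp|]; exact: coef_sum_cvg.
apply/funext => n; rewrite scaler_sumr -big_split /=; apply: eq_bigr => j _.
by rewrite scalerDl scalerA.
Qed.

Definition bproj (n : nat) (x : E) : E := \sum_(i < n) coef x i *: e i.

Lemma bproj_linear n : linear (bproj n).
Proof.
move=> a x y; rewrite /bproj scaler_sumr -big_split /=; apply: eq_bigr => j _.
by rewrite coef_linear scalerDl scalerA.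
Qed.
HB.instance Definition _ n := GRing.isLinear.Build K E E _ (bproj n) (bproj_linear n).

Lemma bprojB n x y : bproj n (x - y) = bproj n x - bproj n y.
Proof. exact: linearB. Qed.

Lemma bprojD n x y : bproj n (x + y) = bproj n x + bproj n y.
Proof. exact: linearD. Qed.

Lemma bprojZ n a x : bproj n (a *: x) = a *: bproj n x.
Proof. exact: linearZ. Qed.

Lemma bproj_cvg x : bproj ^~ x @ \oo --> x.
Proof. exact: coef_sum_cvg. Qed.

Lemma coef_basis i j : coef (e i) j = (i == j)%:R.
Proof.
rewrite (@coef_unique _ (fun j => (i == j)%:R))//.
apply: cvg_near_cst; exists i.+1 => // n /= ni.
rewrite (bigD1 (Ordinal ni))//= eqxx scale1r big1 ?addr0// => k /negPf nk.
by rewrite -[i == k]/(Ordinal ni == k) eq_sym nk scale0r.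
Qed.

Lemma coef0 i : coef 0 i = 0.
Proof. by have := coef_linear (-1) 0 0 i; rewrite scaler0 addr0 mulN1r addNr. Qed.

Lemma coefD x y i : coef (x + y) i = coef x i + coef y i.
Proof. by have := coef_linear 1 x y i; rewrite scale1r mul1r. Qed.

Lemma coefZ a x i : coef (a *: x) i = a * coef x i.
Proof. by have := coef_linear a x 0 i; rewrite addr0 coef0 addr0. Qed.

Lemma coefB x y i : coef (x - y) i = coef x i - coef y i.
Proof. by rewrite -scaleN1r coefD coefZ mulN1r. Qed.

Lemma coef_sum n (a : nat -> K) j :
  coef (\sum_(i < n) a i *: e i) j = if (j < n)%N then a j else 0.
Proof.
elim: n => [|n IH]; first by rewrite big_ord0 coef0.
rewrite big_ord_recr /= coefD IH coefZ coef_basis ltnS.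
by case: ltngtP => [_|_|->]; rewrite ?mulr1 ?add0r ?mulr0 ?addr0.
Qed.

Hypothesis he1 : forall i, `|e i| = 1.

Lemma coef_le (x : E) (M : K) i : (forall n, `|bproj n x| <= M) ->
  `|coef x i| <= M *+ 2.
Proof.
move=> H; rewrite -[leLHS]mulr1 -(he1 i) -normrZ.
have -> : coef x i *: e i = bproj i.+1 x - bproj i x.
  by rewrite /bproj big_ord_recr /= addrAC subrr add0r.
by rewrite (le_trans (ler_normB _ _))// mulr2n lerD.
Qed.

Hypothesis hK : real_or_complex K.

Lemma bproj_bounded x : exists m : nat, forall n, `|bproj n x| <= m%:R.
Proof.
have /cvgrPdist_lt/(_ 1 ltr01)[N _ HN] := @bproj_cvg x.
have [m Hm] := scalars_archimedean hK (\sum_(n < N) `|bproj n x| + (`|x| + 1)).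
rewrite ger0_norm ?addr_ge0 ?sumr_ge0// in Hm.
exists m => n; apply: le_trans Hm.
have [Nn|nN] := leqP N n.
  rewrite -[leLHS]add0r lerD ?sumr_ge0// -lerBlDl.
  by rewrite (le_trans (lerB_dist _ _))// ltW// distrC HN.
rewrite (bigD1 (Ordinal nN))//= -addrA lerDl !addr_ge0//.
by rewrite sumr_ge0.
Qed.

(** By Baire's theorem the points whose partial sums are bounded by some [m] are
    dense in a ball; differences of such points are dense in a ball around 0, and
    scaling by [t] gives the statement. *)
Lemma bproj_approx : exists (D : nat) (r : K), 0 < r /\
  forall (y : E) (t d : K), 0 < t -> 0 < d -> `|y| < r * t ->
    exists u, `|y - u| < d /\ forall n, `|bproj n u| <= D%:R * t.
Proof.
have [m [x0 [r [r0 H]]]] := baire_cover hK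
  (A := fun m => [set x | forall n, `|bproj n x| <= m%:R]) bproj_bounded.
exists (m + m)%N, r; split=> // y t d t0 d0 yr.
have dt0 : 0 < d / t / 2 by rewrite !divr_gt0.
have [|u Hu xu] := H (x0 + t^-1 *: y) _ (d / t / 2) dt0.
  rewrite addrC addKr normrZ gtr0_norm ?invr_gt0//.
  by rewrite mulrC ltr_pdivrMr.
have [|v Hv xv] := H x0 _ (d / t / 2) dt0; first by rewrite subrr normr0.
exists (t *: (u - v)); split; last first.
  move=> n; rewrite bprojZ normrZ gtr0_norm// mulrC (ler_wpM2r (ltW t0))//.
  by rewrite bprojB (le_trans (ler_normB _ _))// natrD lerD.
have -> : y - t *: (u - v) = t *: ((x0 + t^-1 *: y - u) - (x0 - v)).
  rewrite -(addrA x0) (addrC x0 (_ - u)) addrKA.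
  rewrite opprK -[_ - u + v]addrA [- u + v]addrC -(opprB u v) [in RHS]scalerBr.
  by rewrite scalerA divff ?gt_eqF// scale1r.
rewrite normrZ gtr0_norm// mulrC -ltr_pdivlMr//.
by rewrite (le_lt_trans (ler_normB _ _))// [ltRHS]splitr ltrD.
Qed.

(** Banach's theorem. A point of a small ball is a sum of the approximations of
    [bproj_approx] with geometrically decreasing bounds on their partial sums.
    The coefficients of these approximations add up, and the resulting series
    converges to the point, uniformly enough to bound its partial sums;
    uniqueness of the expansion identifies it. *)
Theorem basis_constant : exists2 D : K, 0 < D &
  forall x n, `|bproj n x| <= D * `|x|.
Proof.
have [D [r [r0 approx]]] := bproj_approx.
pose h (k : nat) : K := 2^-1 ^+ k.
have h0 k : 0 < h k by rewrite exprn_gt0// invr_gt0.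
have hS k : h k = h k.+1 + h k.+1.
  have h1 : 2^-1 + 2^-1 = 1 :> K by rewrite -[2^-1]mul1r -splitr.
  by rewrite /h exprS -mulrDl h1 mul1r.
have D0 : 0 <= D%:R :> K by [].
suff key x : `|x| < r -> forall n, `|bproj n x| <= D%:R *+ 2.
  exists (D.+1%:R *+ 2 * (2 / r)).
    by rewrite mulr_gt0 ?divr_gt0// pmulrn_lgt0.
  move=> x n; have [->|x0] := eqVneq x 0; first by rewrite linear0 !normr0 mulr0.
  have nx0 : 0 < `|x| by rewrite normr_gt0.
  pose c := r / 2 / `|x|; have c0 : 0 < c by rewrite !divr_gt0.
  have := key (c *: x); rewrite normrZ gtr0_norm// divfK ?gt_eqF//.
  rewrite ltr_pdivrMr// mulr_natr mulr2n ltrDl => /(_ r0 n).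
  rewrite bprojZ normrZ gtr0_norm// -ler_pdivlMl// => /le_trans; apply.
  have -> : D.+1%:R *+ 2 * (2 / r) * `|x| = c^-1 * (D.+1%:R *+ 2).
    by rewrite /c; field; rewrite !gt_eqF.
  by rewrite ler_wpM2l ?invr_ge0 ?(ltW c0)// lerMn2r ler_nat leqnSn.
move=> xr.
(* [g (k, y)] approximates a remainder [y] smaller than [r * h k]; subtracting
   these approximations one after the other leaves the remainders [rem]. *)
have /choice[g Hg] : forall p : nat * E, exists u : E, `|p.2| < r * h p.1 ->
    `|p.2 - u| < r * h p.1.+1 /\ forall n, `|bproj n u| <= D%:R * h p.1.
  move=> [k y] /=; have [yr|] := pselect (`|y| < r * h k); last by exists 0.
  by have [u [? ?]] := approx y _ _ (h0 k) (mulr_gt0 r0 (h0 k.+1)) yr; exists u.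
pose rem := fix rem k := if k is j.+1 then rem j - g (j, rem j) else x.
have remr k : `|rem k| < r * h k.
  by elim: k => [|k IH] /=; [rewrite /h expr0 mulr1|case: (Hg (k, rem k) IH)].
pose s k := x - rem k.
have step k n : `|bproj n (s k.+1 - s k)| <= D%:R * h k.
  have -> : s k.+1 - s k = g (k, rem k).
    by rewrite /s /= [- (x - rem k)]opprB addrC subrKA subKr.
  by case: (Hg (k, rem k) (remr k)).
have tail N M n : (N <= M)%N -> `|bproj n (s M - s N)| <= D%:R *+ 2 * (h N - h M).
  elim: M => [|M IH]; first by rewrite leqn0 => /eqP->; rewrite !subrr linear0 normr0 mulr0.
  rewrite leq_eqVlt => /orP[/eqP->|]; first by rewrite !subrr linear0 normr0 mulr0.
  rewrite ltnS => /IH {}IH; rewrite -(subrKA (s M)) bprojD.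
  rewrite (le_trans (ler_normD _ _))// (le_trans (lerD (step M n) IH))//.
  by rewrite (hS M) le_eqVlt; apply/orP; left; apply/eqP; ring.
have tail' N M n : (N <= M)%N -> `|bproj n (s M - s N)| <= D%:R *+ 2 * h N.
  move=> /(tail _ _ n)/le_trans; apply; rewrite ler_wpM2l ?mulrn_wge0//.
  by rewrite gerBl ltW.
have small (c d : K) : 0 <= c -> 0 < d -> exists N, forall k, (N <= k)%N -> c * h k < d.
  move=> c0 d0; have c1 : 0 < c + 1 by rewrite ltr_wpDl.
  have [N HN] := half_pow_lt hK (divr_gt0 d0 c1); exists N => k /HN.
  rewrite ltr_pdivlMr// mulrC; apply: le_lt_trans.
  by rewrite ler_wpM2r ?(ltW (h0 k))// lerDl.
have D2 : 0 <= D%:R *+ 2 :> K by rewrite mulrn_wge0.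
have coefs i : exists l : K, (fun k => coef (s k) i) @ \oo --> l.
  apply: (scalars_cauchy_cvg hK) => d d0.
  have [|N HN] := small (D%:R *+ 2 *+ 2) d _ d0; first by rewrite mulrn_wge0.
  have le m k : (N <= m)%N -> (m <= k)%N -> `|coef (s k) i - coef (s m) i| < d.
    move=> Nm mk; have -> : coef (s k) i - coef (s m) i = coef (s k - s m) i.
      by rewrite -coefB.
    apply: le_lt_trans (HN m Nm); rewrite mulrnAl; apply: coef_le => n.
    exact: tail'.
  exists N => m k Nm Nk; have [mk|/ltnW km] := leqP m k; last exact: le.
  by rewrite distrC; exact: le.
have [a Ha] := choice coefs.
have part n : (fun k => bproj n (s k)) @ \oo --> \sum_(i < n) a i *: e i.
  apply: cvg_big => [|i _]; [exact: add_continuous|apply: cvgZr_tmp; exact: Ha].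
have unif N n : `|bproj n (s N) - \sum_(i < n) a i *: e i| <= D%:R *+ 2 * h N.
  apply: (cvg_norm_le (part n)); exists N => // k /= Nk.
  by rewrite distrC -bprojB tail'.
have xa : (fun n => \sum_(i < n) a i *: e i) @ \oo --> x.
  apply/cvgrPdist_lt => d d0.
  have d40 : 0 < d / 2 / 2 by rewrite !divr_gt0.
  have [N1 HN1] := small (D%:R *+ 2) _ D2 d40.
  have [N2 HN2] := small r _ (ltW r0) d40.
  pose N := maxn N1 N2.
  have /cvgrPdist_lt/(_ _ (divr_gt0 d0 (ltr0Sn _ 1))) := @bproj_cvg (s N).
  move=> [N3 _ HN3]; exists N3 => // n /= /HN3 /= sn.
  have -> : x - \sum_(i < n) a i *: e i = rem N + (s N - bproj n (s N)) +
      (bproj n (s N) - \sum_(i < n) a i *: e i).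
    by rewrite -[RHS]addrA subrKA addrA subrKC.
  rewrite (le_lt_trans (ler_normD _ _))// (le_lt_trans (lerD (ler_normD _ _) (lexx _)))//.
  have -> : d = d / 2 / 2 + d / 2 + d / 2 / 2 by field.
  rewrite !ltrD ?(lt_trans (remr N)) ?HN2 ?leq_maxr// (le_lt_trans (unif N n))//.
  by rewrite HN1 ?leq_maxl.
move=> n; have := unif 0%N n; rewrite (_ : s 0%N = 0); last by rewrite /s /= subrr.
rewrite linear0 sub0r normrN /h expr0 mulr1.
by rewrite /bproj (coef_unique xa).
Qed.

End Coefficients.

(** * Ultralimits of operators *)

(** The linear maps below depend on proofs, so they are packed by hand. *)
Definition to_linear (K : numFieldType) (V W : lmodType K) (f : V -> W)
    (lf : linear f) : {linear V -> W} :=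
  HB.pack f (GRing.isLinear.Build K V W _ f lf).

Lemma to_linearE (K : numFieldType) (V W : lmodType K) (f : V -> W)
    (lf : linear f) x : to_linear lf x = f x.
Proof. by []. Qed.

Lemma bounded_operator_nat (K : numFieldType) (hK : real_or_complex K)
    (X Y : completeNormedModType K) (A : {linear X -> Y}) :
  bounded_operator A -> exists m : nat, forall x, `|A x| <= m%:R * `|x|.
Proof.
move=> [M HM]; have [m Hm] := scalars_archimedean hK M; exists m => x.
have M0 : 0 <= M * `|x| := le_trans (normr_ge0 _) (HM x).
apply: le_trans (HM x) _; rewrite -(ger0_norm M0) normrM normr_id.
by rewrite ler_wpM2r.
Qed.

Section Ultralimits.
Variables (K : numFieldType) (hK : real_or_complex K).
Variables (U : set_system nat) (UU : UltraFilter U).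

(** The ultraproduct of the [Y n] is replaced by the completion of [V] for the
    seminorm given by the limit of the norms. *)
Lemma ultralimit_operator (V : lmodType K) (Y : nat -> completeNormedModType K)
    (f : forall n, V -> Y n) :
  (forall n, linear (f n)) ->
  (forall v, exists M : K, forall n, `|f n v| <= M) ->
  exists (F : completeNormedModType K) (g : {linear V -> F}),
    forall v, (fun n => `|f n v|) @ U --> `|g v|.
Proof.
move=> lf bf.
have lim v : exists l : K, (fun n => `|f n v|) @ U --> l.
  have [M HM] := bf v; apply: (@ultra_bounded_cvg _ hK _ _ M) => n.
  by rewrite normr_id.
have [q Hq] := choice lim.
have q0 v : 0 <= q v by apply: (cvg_ge0 _ (@Hq v)); exact: nearW.
have qD u v : q (u + v) <= q u + q v.
  apply: (cvg_le_le _ (@Hq (u + v)) (cvgD (@Hq u) (@Hq v))).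
  apply: nearW => n /=; have := lf n 1 u v; rewrite !scale1r => ->.
  exact: ler_normD.
have qZ a v : q (a *: v) = `|a| * q v.
  apply: (@norm_cvg_unique _ _ ((fun n => `|f n (a *: v)|) @ U)); first exact: Hq.
  rewrite [X in X @ U](_ : _ = fun n => `|a| * `|f n v|).
    by apply: cvgMr; exact: Hq.
  apply/funext => n; have f0 : f n 0 = 0.
    by have := lf n (-1) 0 0; rewrite scaler0 addr0 scaleN1r addNr.
  by have := lf n a v 0; rewrite addr0 f0 addr0 => ->; rewrite normrZ.
have [F [g Hg]] := completion_exists hK (Seminorm q0 qD qZ).
by exists F, g => v; rewrite Hg; exact: Hq.
Qed.

Lemma ultra_cvg_sum (E : normedModType K) (k : nat) (a : nat -> nat -> K)
    (l : nat -> K) (x : nat -> E) :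
  (forall i, (a^~ i) @ U --> l i) ->
  (fun n => \sum_(i < k) a n i *: x i) @ U --> \sum_(i < k) l i *: x i.
Proof.
move=> al; apply: cvg_big => [|i _]; first exact: add_continuous.
by apply: cvgZr_tmp; exact: al.
Qed.

(** A lower bound of the limit seminorm on the span of finitely many vectors is
    inherited, up to a factor 2, by almost all [f n]: otherwise almost every [n]
    has a bad coefficient vector, normalized so that its combination of the [b i]
    has norm 1, and the ultralimit of these vectors violates the bound. The bound
    by [B] on the coefficients is what makes this sphere compact. *)
Lemma ultra_bounded_below (E : completeNormedModType K) (b : nat -> E)
    (Y : nat -> completeNormedModType K) (f : forall n, {linear E -> Y n})
    (t : E -> K) (C : K) (w : nat -> E) (k : nat) (kappa B : K) :
  (forall n u, `|f n u| <= C * `|u|) ->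
  (forall u, (fun n => `|f n u|) @ U --> t u) ->
  (forall (a : nat -> K) i, (i < k)%N -> `|a i| <= B * `|\sum_(i < k) a i *: b i|) ->
  0 < kappa ->
  (forall a : nat -> K, kappa * `|\sum_(i < k) a i *: b i| <=
                        t (\sum_(i < k) a i *: w i)) ->
  U [set n | forall a : nat -> K, kappa / 2 * `|\sum_(i < k) a i *: b i| <=
                       `|f n (\sum_(i < k) a i *: w i)|].
Proof.
move=> fC ft bB k0 tw; set G := [set n | _].
have [//|UG] := in_ultra_setVsetC G UU; exfalso.
have bad n : exists a : nat -> K, (forall i, `|a i| <= `|B|) /\
    (~ G n -> `|\sum_(i < k) a i *: b i| = 1 /\
              `|f n (\sum_(i < k) a i *: w i)| <= kappa / 2).
  have [Gn|nGn] := pselect (G n).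
    by exists (fun=> 0); split=> // i; rewrite normr0.
  have [a /negP Ha] : exists a : nat -> K, ~ kappa / 2 * `|\sum_(i < k) a i *: b i| <=
      `|f n (\sum_(i < k) a i *: w i)| by apply/existsNP.
  rewrite -real_ltNge ?normr_real ?ger0_real ?mulr_ge0 ?divr_ge0 ?(ltW k0)// in Ha.
  set N := `|\sum_(i < k) a i *: b i| in Ha.
  have N0 : 0 < N.
    rewrite lt_def normr_ge0 andbT; apply: contraTneq Ha => ->.
    by rewrite mulr0 normr_lt0.
  have sumE (V : lmodType K) (v : nat -> V) :
      \sum_(i < k) (if (i < k)%N then N^-1 * a i else 0) *: v i =
      N^-1 *: \sum_(i < k) a i *: v i.
    by rewrite scaler_sumr; apply: eq_bigr => i _; rewrite ltn_ord scalerA.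
  exists (fun i => if (i < k)%N then N^-1 * a i else 0); split=> [i|_].
    case: ifPn => [ik|_]; last by rewrite normr0.
    rewrite normrM gtr0_norm ?invr_gt0// mulrC ler_pdivrMr//.
    apply: (le_trans (bB a i ik)); rewrite -/N ler_wpM2r ?(ltW N0)//.
    have := le_trans (normr_ge0 _) (bB a i ik); rewrite pmulr_lge0// => B1.
    by rewrite ger0_norm.
  rewrite !sumE linearZ /= !normrZ gtr0_norm ?invr_gt0// -/N mulVf ?gt_eqF//.
  by split=> //; rewrite mulrC ler_pdivrMr// ltW.
have [a Ha] := choice bad.
have lim i : exists l : K, (a^~ i) @ U --> l.
  by apply: (@ultra_bounded_cvg _ hK _ _ `|B|) => n; case: (Ha n).
have [l Hl] := choice lim.
pose wl := \sum_(i < k) l i *: w i; pose bl := \sum_(i < k) l i *: b i.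
have bl1 : `|bl| = 1.
  apply: (@norm_cvg_unique _ _ ((fun n => `|\sum_(i < k) a n i *: b i|) @ U)).
    by apply: cvg_norm; exact: ultra_cvg_sum.
  apply: cvg_near_cst; apply: filterS UG => n nG.
  by case: (Ha n) => _ /(_ nG)[].
have : t wl <= kappa / 2 + C * `|wl - wl|.
  apply: (@cvg_le_le _ _ U (fun n => `|f n wl|)
    (fun n => kappa / 2 + C * `|wl - \sum_(i < k) a n i *: w i|)) => //.
    apply: cvgD; first exact: cvg_cst.
    apply: cvgMr; apply: cvg_norm; apply: cvgB; first exact: cvg_cst.
    exact: ultra_cvg_sum.
  apply: filterS UG => n nG; have [_ /(_ nG)[_ fw]] := Ha n.
  rewrite addrC -[X in f n X](subrK (\sum_(i < k) a n i *: w i)) linearD.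
  by rewrite (le_trans (ler_normD _ _))// lerD.
rewrite subrr normr0 mulr0 addr0 => /(le_trans (tw l)).
rewrite -/bl bl1 mulr1 {1}(splitr kappa) gerDl => /(lt_le_trans (divr_gt0 k0 (ltr0Sn _ 1))).
by rewrite ltxx.
Qed.

End Ultralimits.

(** * Perturbing a copy of the basis into a countable set *)

(** [w] codes a finite coefficient sequence through the enumeration [d] of a dense
    set of scalars; the same code can be evaluated on vectors of any space. *)
Definition coded_comb (K : numFieldType) (d : nat -> K) (V : lmodType K) (x : nat -> V)
  (w : seq nat) : V := \sum_(j < size w) d w`_j *: x j.

Section Perturbation.
Variables (K : numFieldType) (hK : real_or_complex K).
Variables (E : completeNormedModType K) (e : nat -> E).
Hypotheses (hb : schauder_basis e) (he1 : forall i, `|e i| = 1).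
Variables (D : K) (D0 : 0 < D) (HD : forall x n, `|bproj hb n x| <= D * `|x|).
Variable d : nat -> K.
Hypothesis dense_d : forall (x r : K), 0 < r -> exists n, `|x - d n| < r.

(** The bound does not depend on the length [k]; this is where a perturbation
    argument for infinite sequences needs the basis constant. *)
Lemma coef_bound (a : nat -> K) k i : (i < k)%N ->
  `|a i| <= (D *+ 2) * `|\sum_(i < k) a i *: e i|.
Proof.
move=> ik; have := coef_sum hb k a i; rewrite ik => <-.
by rewrite mulrnAl; apply: (coef_le he1) => n.
Qed.

Lemma comb_dense (z : E) (r : K) : 0 < r -> exists w, `|z - coded_comb d e w| < r.
Proof.
move=> r0; have r20 : 0 < r / 2 by rewrite divr_gt0.
have /cvgrPdist_lt/(_ _ r20)[n _ /(_ n (leqnn n)) /= zn] := @bproj_cvg _ _ _ hb z.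
have rn0 : 0 < r / 2 / n.+1%:R by rewrite divr_gt0// ltr0n.
have [g Hg] := choice (fun j => dense_d (coef hb z j) rn0).
exists (mkseq g n); rewrite -(subrKA (bproj hb n z)).
rewrite (le_lt_trans (ler_normD _ _))// [ltRHS]splitr ltr_leD//.
rewrite /coded_comb size_mkseq /bproj -sumrB (le_trans (ler_norm_sum _ _ _))//.
apply: (@le_trans _ _ (\sum_(i < n) r / 2 / n.+1%:R)).
  apply: ler_sum => i _; rewrite -scalerBl normrZ he1 mulr1 nth_mkseq//.
  by rewrite ltW.
rewrite sumr_const card_ord -[leLHS]mulr_natr -mulrA ler_piMr ?(ltW r20)//.
by rewrite mulrC ler_pdivrMr ?ltr0n// mul1r ler_nat.
Qed.

(** The [i]-th vector is moved by so little that, by [coef_bound], the error of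
    the [i]-th term is at most [eta * 2^-(i+1)] times the norm of the sum. *)
Lemma perturb_basis (z : nat -> E) (eta : K) : 0 < eta -> exists w : nat -> seq nat,
  forall k (a : nat -> K),
    `|\sum_(i < k) a i *: z i - \sum_(i < k) a i *: coded_comb d e (w i)|
      <= eta * `|\sum_(i < k) a i *: e i|.
Proof.
move=> eta0; pose r i := eta * 2^-1 ^+ i.+1 / (D *+ 2).
have D20 : 0 < D *+ 2 by rewrite pmulrn_lgt0.
have r0 i : 0 < r i by rewrite /r divr_gt0// mulr_gt0// exprn_gt0// invr_gt0.
have [w Hw] := choice (fun i => comb_dense (z i) (r0 i)).
exists w => k a; rewrite -sumrB; set N := `|\sum_(i < k) a i *: e i|.
rewrite (le_trans (ler_norm_sum _ _ _))//.
apply: (@le_trans _ _ (\sum_(i < k) eta * N * 2^-1 ^+ i.+1)).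
  apply: ler_sum => i _; rewrite -scalerBr normrZ.
  rewrite (le_trans (ler_pM _ _ (coef_bound a (ltn_ord i)) (ltW (Hw i))))//.
  rewrite -/N /r le_eqVlt; apply/orP; left; apply/eqP; field.
  by rewrite gt_eqF.
rewrite -mulr_sumr ler_piMr ?(mulr_ge0 (ltW eta0)) ?normr_ge0//.
have -> : \sum_(i < k) 2^-1 ^+ i.+1 = 1 - 2^-1 ^+ k :> K.
  elim: k {N} => [|k IH]; first by rewrite big_ord0 expr0 subrr.
  by rewrite big_ord_recr /= IH exprS; field.
by rewrite gerBl exprn_ge0// invr_ge0.
Qed.

(** The copy [j] is first shrunk by [lam] to make room for the factor [D] in the
    upper estimate, then perturbed with an error that costs at most half of the
    lower estimate. *)
Lemma perturb_copy (F : completeNormedModType K) (T : {linear E -> F})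
    (j : {linear E -> E}) (m C : nat) (c : K) :
  (forall u, `|j u| <= m%:R * `|u|) -> (forall u, `|T u| <= C%:R * `|u|) ->
  0 < c ->
  (forall k (a : nat -> K), c * `|\sum_(i < k) a i *: e i| <=
     `|T (j (\sum_(i < k) a i *: e i))|) ->
  exists (w : nat -> seq nat) (kappa : K), 0 < kappa /\
  forall k (a : nat -> K),
    D * `|\sum_(i < k) a i *: coded_comb d e (w i)| <= `|\sum_(i < k) a i *: e i| /\
    kappa * `|\sum_(i < k) a i *: e i| <= `|T (\sum_(i < k) a i *: coded_comb d e (w i))|.
Proof.
move=> jm TC c0 Tj.
pose lam : K := (D * 2 * m.+1%:R)^-1.
have lam0 : 0 < lam by rewrite invr_gt0 !mulr_gt0// ltr0n.
have [eta [eta0 eta1 eta2]] : exists eta : K,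
    [/\ 0 < eta, eta <= (D * 2)^-1 & eta <= lam * c / 2 / C.+1%:R].
  by apply: pos_lower_bound; rewrite ?invr_gt0 ?mulr_gt0// ?invr_gt0 ?ltr0n.
have [w Hw] := perturb_basis (fun i => lam *: j (e i)) eta0.
exists w, (lam * c / 2); split; first by rewrite !mulr_gt0// invr_gt0.
move=> k a; set b := \sum_(i < k) a i *: e i; set W := \sum_(i < k) _.
have zE : \sum_(i < k) a i *: (lam *: j (e i)) = lam *: j b.
  rewrite /b linear_sum scaler_sumr; apply: eq_bigr => i _.
  by rewrite [j (_ *: _)]linearZ /= !scalerA mulrC.
have := Hw k a; rewrite -/W -/b zE => Wb; split.
  rewrite -[W](subrK (lam *: j b)) mulrC -ler_pdivlMr//.
  rewrite (le_trans (ler_normD _ _))// distrC (le_trans (lerD Wb (lexx _)))//.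
  rewrite normrZ (gtr0_norm lam0) (le_trans (lerD (lexx _) (ler_wpM2l (ltW lam0) (jm b))))//.
  rewrite mulrA -mulrDl mulrC ler_wpM2l//.
  apply: (@le_trans _ _ ((D * 2)^-1 + lam * m.+1%:R)).
    by rewrite lerD// ler_wpM2l ?(ltW lam0)// ler_nat.
  rewrite le_eqVlt; apply/orP; left; apply/eqP; rewrite /lam.
  have m0 : m.+1%:R != 0 :> K by rewrite pnatr_eq0.
  by field; rewrite gt_eqF// nat1r m0.
have TW : T W = lam *: T (j b) - T (lam *: j b - W).
  by rewrite [T (_ - _)]linearB linearZ /= subKr.
rewrite TW; apply: le_trans (lerB_dist _ _).
rewrite normrZ (gtr0_norm lam0) lerBrDr.
have H1 : lam * (c * `|b|) <= lam * `|T (j b)| by rewrite ler_wpM2l ?(ltW lam0)// Tj.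
apply: le_trans H1.
have H2 : `|T (lam *: j b - W)| <= C.+1%:R * (lam * c / 2 / C.+1%:R * `|b|).
  apply: (le_trans (TC _)); apply: ler_pM => //; first by rewrite ler_nat.
  by apply: (le_trans Wb); rewrite ler_wpM2r.
apply: (le_trans (lerD (lexx _) H2)).
rewrite le_eqVlt; apply/orP; left; apply/eqP.
have C0 : C.+1%:R != 0 :> K by rewrite pnatr_eq0.
by field.
Qed.

End Perturbation.

(** * Coding pairs of operators by sequences of natural numbers *)

(** Reads off an enumeration of [T] in which every item occurs at infinitely many
    positions, since [logn 2] takes each value infinitely often. *)
Definition item_at (T : countType) (dflt : T) (i : nat) : T :=
  odflt dflt (unpickle (logn 2 i)).

Lemma item_at_unbounded (T : countType) (dflt : T) (x : T) (N : nat) :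
  exists2 i, (N <= i)%N & item_at dflt i = x.
Proof.
exists (2 ^ pickle x * N.*2.+1)%N.
  rewrite (leq_trans _ (leq_pmull _ _)) ?expn_gt0// (leq_trans _ (leqnSn _))//.
  by rewrite -addnn leq_addr.
rewrite /item_at lognM ?expn_gt0// pfactorK// logn_coprime ?addn0 ?pickleK//.
by rewrite coprime2n /= odd_double.
Qed.

Section Codes.
Variables (K : numFieldType) (E : completeNormedModType K) (e : nat -> E).
Variables (M : nat) (dec : bool -> nat -> Ord) (d : nat -> K).

Definition ranks (X : Type) (T : set (seq X)) (dd : nat -> Ord) (rho : seq X -> nat) :=
  forall s t, t <> [::] -> T (s ++ t) -> ord_lt (dd (rho (s ++ t))) (dd (rho s)).

(** A pair of operators, [sysA true] and [sysA false], with rank functions for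
    all their trees and a node of the tree of their sum. The rank functions take
    values in natural numbers, decoded by [dec]. *)
Record system := System {
  sysX : completeNormedModType K;
  sysY : completeNormedModType K;
  sysA : bool -> {linear sysX -> sysY};
  sys_rank : bool -> nat -> seq sysX -> nat;
  sys_seq : seq sysX;
  sys_bound : forall b x, `|sysA b x| <= M%:R * `|x|;
  sys_ranks : forall b m, ranks (NP_tree e (sysA b) m.+1%:R) (dec b) (sys_rank b m);
  sys_tree : NP_tree e (sysA true \+ sysA false) M%:R sys_seq }.

Definition entry_item := item_at (true, 0%N, [::] : seq (seq nat)).

(** The node is truncated to its first [i + 1] vectors so that the entry does not
    change when the node is extended; the default value 0 of [nth] fills in for the
    vectors that are not there yet. *)
Definition entry (X : completeNormedModType K) (rho : bool -> nat -> seq X -> nat)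
    (s : seq X) (i : nat) : nat :=
  let: (b, m, ws) := entry_item i in
  rho b m [seq coded_comb d (nth 0 (take i.+1 s)) w | w <- ws].

Definition code (X : completeNormedModType K) (rho : bool -> nat -> seq X -> nat)
    (s : seq X) : seq nat := mkseq (entry rho s) (size s).

Lemma code_cat (X : completeNormedModType K) (rho : bool -> nat -> seq X -> nat) s t :
  exists2 t', size t' = size t & code rho (s ++ t) = code rho s ++ t'.
Proof.
exists [seq entry rho (s ++ t) i | i <- iota (size s) (size t)].
  by rewrite size_map size_iota.
rewrite /code /mkseq size_cat iotaD map_cat; congr (_ ++ _).
apply/eq_in_map => i; rewrite mem_iota => /= is_; rewrite /entry.
by rewrite takel_cat.
Qed.

Definition codes : set (seq nat) :=
  [set c | exists r : system, c = code (sys_rank (s := r)) (sys_seq r)].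

Lemma codes_tree : is_tree codes.
Proof.
move=> c c' [[X Y A rho s bA rA tA] /= e']; set n := size c.
have trA := @NP_tree_is_tree _ _ e _ _ (A true \+ A false) M%:R.
have tn : NP_tree e (A true \+ A false) M%:R (take n s).
  by apply: (trA _ (drop n s)); rewrite cat_take_drop.
exists (System bA rA tn) => /=.
have [t' _] := code_cat rho (take n s) (drop n s).
have ns : (n <= size s)%N.
  by have := congr1 size e'; rewrite size_cat size_mkseq => <-; exact: leq_addr.
rewrite cat_take_drop -e' => /(congr1 (take n)).
rewrite take_size_cat// take_size_cat// /code size_mkseq size_takel//.
Qed.

(** [code rho] is a map of trees from the tree of the sum into the tree of codes. *)
Lemma order_le_codes (X Y : completeNormedModType K) (A : bool -> {linear X -> Y})
    (rho : bool -> nat -> seq X -> nat) a :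
  (forall b x, `|A b x| <= M%:R * `|x|) ->
  (forall b m, ranks (NP_tree e (A b) m.+1%:R) (dec b) (rho b m)) ->
  iter_derived codes a = set0 ->
  iter_derived (NP_tree e (A true \+ A false) M%:R) a = set0.
Proof.
move=> bA rA c0; rewrite -subset0 => s Hs.
suff : iter_derived codes a (code rho s) by rewrite c0.
apply: (iter_derived_map (T := NP_tree e (A true \+ A false) M%:R)) Hs => //.
- exact: NP_tree_is_tree.
- exact: codes_tree.
- by move=> t Ht; exists (System bA rA Ht).
- move=> s' t t0; have [t' st' ->] := code_cat rho s' t; exists t' => // t'0.
  by case: t st' t0 => // ? ?; rewrite t'0.
Qed.

End Codes.

(** * An infinite branch contradicts property (S') *)

Section Branch.
Variables (K : numFieldType) (hK : real_or_complex K).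
Variables (E : completeNormedModType K) (e : nat -> E).
Hypotheses (hb : schauder_basis e) (he1 : forall i, `|e i| = 1).
Variables (D : K) (D0 : 0 < D) (HD : forall x n, `|bproj hb n x| <= D * `|x|).
Variables (d : nat -> K).
Hypothesis dense_d : forall (x r : K), 0 < r -> exists n, `|x - d n| < r.
Variables (M : nat) (dec : bool -> nat -> Ord).
Variables (r : nat -> system e M dec) (b : nat -> nat).
Hypothesis branch : forall n, code d (sys_rank (s := r n)) (sys_seq (r n)) = mkseq b n.
Variables (U : set_system nat) (UU : UltraFilter U) (oU : \oo `<=` U).

Let s n := sys_seq (r n).
Let A n := sysA (r n).

Lemma branch_size n : size (s n) = n.
Proof. by have := congr1 size (branch n); rewrite !size_mkseq. Qed.

Lemma branch_entry n i : (i < n)%N -> entry d (sys_rank (s := r n)) (s n) i = b i.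
Proof.
move=> i_n; have := congr1 (nth 0%N ^~ i) (branch n).
by rewrite /code !nth_mkseq// branch_size.
Qed.

Lemma ultra_ge N : U [set n | (N <= n)%N].
Proof. by apply: oU; exists N. Qed.

(** The map [e_i |-> s_i] on the span of the first [n] basis vectors, extended
    to [E] by the basis projection. *)
Definition transfer n (u : E) : sysX (r n) := \sum_(i < n) coef hb u i *: (s n)`_i.

Lemma transfer_linear n : linear (transfer n).
Proof.
move=> a x y; rewrite /transfer scaler_sumr -big_split /=; apply: eq_bigr => i _.
by rewrite coef_linear scalerDl scalerA.
Qed.

Lemma transfer_le n u : `|transfer n u| <= `|bproj hb n u|.
Proof.
have [_ dom _] := sys_tree (r n); have := dom (coef hb u).
by rewrite -/(s n) branch_size mul1r.
Qed.

Lemma transfer_le_norm n u : `|transfer n u| <= D * `|u|.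
Proof. exact: le_trans (transfer_le n u) (HD u n). Qed.

Lemma transfer_ge n u :
  `|bproj hb n u| <= M%:R * `|A n true (transfer n u) + A n false (transfer n u)|.
Proof.
have [_ _ dom] := sys_tree (r n); have := dom (coef hb u).
rewrite -/(s n) branch_size; congr (_ <= _ * `| _ |).
rewrite /transfer !linear_sum -big_split /=; apply: eq_bigr => i _.
by rewrite !linearZ /= -scalerDr.
Qed.

Lemma transfer_comb n w : (size w <= n)%N ->
  transfer n (coded_comb d e w) = coded_comb d (nth 0 (s n)) w.
Proof.
move=> wn; pose F (i : nat) : sysX (r n) := d (nth 0%N w i) *: (s n)`_i.
rewrite /transfer /coded_comb (big_ord_widen n F)//.
rewrite [RHS]big_mkcond /=; apply: eq_bigr => i _.
rewrite (coef_sum hb (size w) (fun i => d (nth 0%N w i))).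
by case: ifP => // _; rewrite scale0r.
Qed.

(** If the ultralimit [T] preserved a copy of the basis, the images under
    [transfer n] of a perturbed copy [w] would lie, for almost all [n], in the tree
    of [A n fl] with one fixed constant. Their ranks are entries of the branch
    [b] and would decrease for ever. *)
Lemma branch_no_copy (F : completeNormedModType K) (T : {linear E -> F}) (fl : bool) :
  (forall u, (fun n => `|A n fl (transfer n u)|) @ U --> `|T u|) ->
  ~ preserves_copy e T.
Proof.
move=> AT [Z [j [bj [c1 c10 jc] jZ [c2 c20 Tc]]]].
have [C HC] : exists C : nat, forall n u, `|A n fl (transfer n u)| <= C%:R * `|u|.
  have [C HC] := scalars_archimedean hK (M%:R * D); exists C => n u.
  apply: (le_trans (sys_bound fl (transfer n u))).
  apply: (le_trans (ler_wpM2l (ler0n _ M) (transfer_le_norm n u))).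
  rewrite mulrA ler_wpM2r//; apply: le_trans HC.
  by rewrite ger0_norm ?mulr_ge0// ltW.
have TC u : `|T u| <= C%:R * `|u|.
  by apply: (cvg_le_le _ (AT u) (cvg_cst _)); apply: nearW.
have [m jm] := bounded_operator_nat hK bj.
have cc : 0 < c2 * c1 by rewrite mulr_gt0.
have Tj k (a : nat -> K) : c2 * c1 * `|\sum_(i < k) a i *: e i| <=
    `|T (j (\sum_(i < k) a i *: e i))|.
  set v := \sum_(i < k) _.
  have vs : closed_span e v by apply: subset_closure; exists k, a.
  have /Tc H : Z (j v) by rewrite -jZ; exists v.
  by apply: le_trans H; rewrite -mulrA ler_wpM2l ?(ltW c20)// jc.
have [w [kap [kap0 Hw]]] := perturb_copy he1 D0 HD dense_d jm TC cc Tj.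
have lf n : linear (fun u => A n fl (transfer n u)).
  by move=> a x y; rewrite transfer_linear linearP.
have below k := @ultra_bounded_below K hK U UU E e _ (fun n => to_linear (lf n))
  (fun u => `|T u|) C%:R (fun i => coded_comb d e (w i)) k kap (D *+ 2)
  HC AT (fun a i ik => coef_bound he1 HD a ik) kap0 (fun a => proj2 (Hw k a)).
have [p Hp] := scalars_archimedean hK (kap / 2)^-1.
have {}Hp : (kap / 2)^-1 <= p.+1%:R.
  apply: le_trans (_ : p%:R <= _); last by rewrite ler_nat.
  by apply: le_trans Hp; rewrite ger0_norm// invr_ge0 divr_ge0// ltW.
pose tup n k := mkseq (fun i => coded_comb d (nth 0 (s n)) (w i)) k.
have inT k : U [set n | NP_tree e (A n fl) p.+1%:R (tup n k)].
  apply: filterS (filterI (below k) (ultra_ge (\sum_(i < k) size (w i)))) => n.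
  move=> [/= blw wn].
  have tE i : (i < k)%N -> (tup n k)`_i = transfer n (coded_comb d e (w i)).
    move=> ik; rewrite nth_mkseq// transfer_comb// (leq_trans _ wn)//.
    by rewrite (bigD1 (Ordinal ik))//= leq_addr.
  have sE (a : nat -> K) : \sum_(i < k) a i *: (tup n k)`_i =
      transfer n (\sum_(i < k) a i *: coded_comb d e (w i)).
    rewrite -(to_linearE (transfer_linear n)) linear_sum; apply: eq_bigr => i _.
    by rewrite linearZ /= tE.
  have dom : dominated 1 k (fun i => (tup n k)`_i) e.
    move=> a; rewrite sE mul1r; apply: le_trans (transfer_le_norm _ _) _.
    by case: (Hw k a).
  rewrite /NP_tree /= size_mkseq; split=> // [i ik|a].
    have pick (V : lmodType K) (v : nat -> V) :
        \sum_(l < k) (nat_of_ord l == i)%:R *: v l = v i.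
      rewrite (bigD1 (Ordinal ik))//= eqxx scale1r big1 ?addr0// => l.
      by rewrite -val_eqE /= => /negPf->; rewrite scale0r.
    by have := dom (fun l => (l == i)%:R); rewrite !pick he1 mulr1.
  have := blw a; rewrite -ler_pdivlMl ?divr_gt0// => /le_trans; apply.
  have -> : \sum_(i < k) a i *: A n fl (tup n k)`_i =
      A n fl (transfer n (\sum_(i < k) a i *: coded_comb d e (w i))).
    by rewrite -sE linear_sum; apply: eq_bigr => i _; rewrite linearZ.
  by rewrite ler_wpM2r.
(* A position that records the rank of the first [k] vectors of [w], late enough
   for all their coordinates to be available. *)
have /choice[ps Hps] k : exists i, (\sum_(i < k) size (w i) <= i)%N /\
    entry_item i = (fl, p, mkseq w k).
  have [i i1 i2] := item_at_unbounded (true, 0%N, [::]) (fl, p, mkseq w k)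
    (\sum_(i < k) size (w i))%N.
  by exists i.
have rankE k n : (ps k < n)%N -> sys_rank (s := r n) fl p (tup n k) = b (ps k).
  move=> pn; rewrite -(branch_entry pn) /entry.
  have [le ->] := Hps k; congr sys_rank; rewrite /mkseq -map_comp.
  apply/eq_in_map => i; rewrite mem_iota add0n => /= ik.
  apply: eq_bigr => l _; rewrite nth_take//.
  rewrite ltnS (leq_trans _ le)// (bigD1 (Ordinal ik))//=.
  by rewrite (leq_trans (ltnW (ltn_ord l)))// leq_addr.
have decr k : ord_lt (dec fl (b (ps k.+1))) (dec fl (b (ps k))).
  have [n [Tn /= n1]] := filter_ex (filterI (inT k.+1)
    (ultra_ge (maxn (ps k) (ps k.+1)).+1)).
  move: n1; rewrite gtn_max => /andP[n0 n1].
  rewrite -!(rankE _ n)//.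
  have tupS : tup n k.+1 = tup n k ++ [:: coded_comb d (nth 0 (s n)) (w k)].
    by rewrite /tup mkseqS cats1.
  move: Tn => /=; rewrite tupS; exact: sys_ranks.
have : forall x k, x <> dec fl (b (ps k)).
  elim/(well_founded_ind ord_lt_wf) => x IH k xk.
  by apply: (IH _ _ k.+1 erefl); rewrite xk.
by move=> /(_ _ 0%N erefl).
Qed.

(** Both ultralimits preserve no copy of the basis, but their sum is bounded below
    because the segments of the branch come from nodes of the trees of the sums
    with the constant [M]. *)
Lemma no_branch : property_S' e -> False.
Proof.
move=> hS.
pose f n (uv : (E * E)%type) := A n true (transfer n uv.1) + A n false (transfer n uv.2).
have lf n : linear (f n).
  move=> a [x y] [x' y']; rewrite /f /= !transfer_linear !linearP.
  by rewrite scalerDr addrACA.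
have le n fl u : `|A n fl (transfer n u)| <= M%:R * (D * `|u|).
  apply: (le_trans (sys_bound fl (transfer n u))).
  by rewrite ler_wpM2l// transfer_le_norm.
have bf uv : exists C : K, forall n, `|f n uv| <= C.
  exists (M%:R * (D * `|uv.1|) + M%:R * (D * `|uv.2|)) => n.
  by rewrite (le_trans (ler_normD _ _))// lerD.
have [F [g Hg]] := ultralimit_operator hK UU lf bf.
have l1 : linear (fun u : E => g (u, 0)).
  by move=> a x y; rewrite -linearP; congr (g (_, _)); rewrite /= scaler0 addr0.
have l2 : linear (fun u : E => g (0, u)).
  by move=> a x y; rewrite -linearP; congr (g (_, _)); rewrite /= scaler0 addr0.
have t0 n : transfer n 0 = 0 by rewrite -(to_linearE (transfer_linear n)) linear0.
have c1 u : (fun n => `|A n true (transfer n u)|) @ U --> `|to_linear l1 u|.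
  apply: cvg_trans (@Hg (u, 0)); apply: near_eq_cvg; apply: nearW => n.
  by rewrite /f /= t0 linear0 addr0.
have c2 u : (fun n => `|A n false (transfer n u)|) @ U --> `|to_linear l2 u|.
  apply: cvg_trans (@Hg (0, u)); apply: near_eq_cvg; apply: nearW => n.
  by rewrite /f /= t0 linear0 add0r.
have bd fl (T : {linear E -> F}) :
    (forall u, (fun n => `|A n fl (transfer n u)|) @ U --> `|T u|) ->
    bounded_operator T.
  move=> AT; exists (M%:R * D) => u; rewrite -mulrA.
  by apply: (cvg_le_le _ (AT u) (cvg_cst _)); apply: nearW.
have J1 : NP_class e (to_linear l1) by split; [exact: bd c1|exact: branch_no_copy c1].
have J2 : NP_class e (to_linear l2) by split; [exact: bd c2|exact: branch_no_copy c2].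
have [_ []] := ideal_add hS J1 J2.
exists (closed_span e), (idfun : {linear E -> E}); split.
- by exists 1 => x; rewrite mul1r.
- by exists 1 => // x _; rewrite mul1r.
- by rewrite image_id.
exists M.+1%:R^-1; first by rewrite invr_gt0 ltr0n.
move=> u _; rewrite ler_pdivrMl ?ltr0n//.
have sumE : to_linear l1 u + to_linear l2 u = g (u, u).
  by rewrite /= -linearD; congr (g (_, _)); rewrite /= ?addr0 ?add0r.
suff : `|u| <= M.+1%:R * `|g (u, u)| by rewrite -sumE.
have pu : (fun n => `|bproj hb n u|) @ U --> `|u|.
  apply: cvg_norm; apply: cvg_trans (@bproj_cvg _ _ _ hb u).
  by move=> B /= HB; exact: oU.
apply: (cvg_le_le _ pu (cvgMr (a := M.+1%:R) (@Hg (u, u)))).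
apply: nearW => n; apply: le_trans (transfer_ge n u) _.
by rewrite ler_wpM2r// ler_nat.
Qed.

End Branch.

(** * The bound *)

Lemma least_le (P : Ord -> Prop) a : P a -> xord_le (least P) (Some a).
Proof.
move=> Pa; case E : (least P) => [b|] /=; first by case/leastP : E => _; exact.
by move/least_None : E => /(_ a).
Qed.

Section Bound.
Variables (K : numFieldType) (hK : real_or_complex K).
Variables (E : completeNormedModType K) (e : nat -> E).
Hypotheses (he : normalized_schauder_basis e) (hS : property_S' e).

Lemma codes_countable (M : nat) (dec : bool -> nat -> Ord) (d : nat -> K) :
  (forall (x r : K), 0 < r -> exists n, `|x - d n| < r) ->
  exists2 a, ord_countable a & iter_derived (codes e M dec d) a = set0.
Proof.
move=> dense_d; apply: wf_tree_countable; first exact: codes_tree.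
move=> b /choice[r Hr]; have [hb he1] := he.
have [D D0 HD] := basis_constant hb he1 hK.
have [U [UU oU]] := nat_ultrafilter.
exact: (no_branch hK he1 D0 HD dense_d (fun n => esym (Hr n)) UU oU hS).
Qed.

Lemma NP_tree_mono (X Y : completeNormedModType K) (A : {linear X -> Y}) (C C' : K) :
  C <= C' -> NP_tree e A C `<=` NP_tree e A C'.
Proof.
move=> CC' s [s1 s2 s3]; split=> // a; apply: le_trans (s3 a) _.
by rewrite ler_wpM2r.
Qed.

Lemma iter_derived_mono (S : Type) (T T' : set (seq S)) a :
  is_tree T -> is_tree T' -> T `<=` T' -> iter_derived T a `<=` iter_derived T' a.
Proof.
move=> trT trT' TT' s; apply: (iter_derived_map (phi := id)) => // {}s t t0.
by exists t.
Qed.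

Lemma NP_index_derived (X Y : completeNormedModType K) (A : {linear X -> Y}) xi :
  NP_index e A = Some xi ->
  forall m, iter_derived (NP_tree e A m.+1%:R) xi = set0.
Proof.
move=> /leastP[H _] m; apply/tree_order_le; first exact: NP_tree_is_tree.
by apply: H; rewrite ler1n.
Qed.

(** The integer [M] collects the norms of both operators and the constant of the
    tree of the sum; only countably many values occur, so one countable ordinal
    exceeds the orders of all the trees of codes. *)
Lemma NP_index_sum_bound (xi zeta : Ord) : ord_countable xi -> ord_countable zeta ->
  exists a, [/\ ord_lt ord_zero a, ord_countable a &
    forall (X Y : completeNormedModType K) (A B : {linear X -> Y}),
      bounded_operator A -> bounded_operator B ->
      NP_index e A = Some xi -> NP_index e B = Some zeta ->
      xord_le (NP_index e (A \+ B)) (Some a)].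
Proof.
move=> /countable_ranking[dx Hdx] /countable_ranking[dz Hdz].
have [d dense_d] := scalars_dense_sequence hK.
pose dec (b : bool) := if b then dx else dz.
have cod M : exists a, ord_countable a /\ iter_derived (codes e M dec d) a = set0.
  by have [a] := codes_countable M dec dense_d; exists a.
have [aM HaM] := choice cod.
have [a [ca la]] := ord_countable_sup (fun M => proj1 (HaM M)).
exists a; split=> //; first exact: ole_olt_trans (ord_zero_le _) (la 0%N).
move=> X Y A B bA bB NA NB; apply: least_le => C C1.
apply/tree_order_le; first exact: NP_tree_is_tree.
have [mA HA] := bounded_operator_nat hK bA.
have [mB HB] := bounded_operator_nat hK bB.
have [mC HC] := scalars_archimedean hK C.
pose M := maxn mC (maxn mA mB).
pose AB (b : bool) := if b then A else B.
have bAB b x : `|AB b x| <= M%:R * `|x|.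
  case: b; [apply: le_trans (HA x) _|apply: le_trans (HB x) _].
    by rewrite ler_wpM2r// ler_nat /M !leq_max leqnn orbT.
  by rewrite ler_wpM2r// ler_nat /M !leq_max leqnn !orbT.
have /choice[rho Hrho] : forall bm : bool * nat, exists rho : seq X -> nat,
    ranks (NP_tree e (AB bm.1) bm.2.+1%:R) (dec bm.1) rho.
  move=> [b m] /=; case: b.
    by apply: Hdx; [exact: NP_tree_is_tree|exact: NP_index_derived].
  by apply: Hdz; [exact: NP_tree_is_tree|exact: NP_index_derived].
have ca0 : iter_derived (codes e M dec d) a = set0.
  rewrite -subset0 -(proj2 (HaM M)).
  by apply: code_derived_anti; [exact: codes_tree|exact: oltW (la M)].
have sub : NP_tree e (A \+ B) C `<=` NP_tree e (A \+ B) M%:R.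
  apply: NP_tree_mono; rewrite -[C]ger0_norm ?(le_trans _ C1)//.
  by rewrite (le_trans HC)// ler_nat leq_maxl.
rewrite -subset0.
rewrite -(order_le_codes (A := AB) (rho := fun b m => rho (b, m)) bAB
  (fun b m => Hrho (b, m)) ca0).
by apply: iter_derived_mono => //; exact: NP_tree_is_tree.
Qed.

End Bound.

Theorem theorem8p2 (K : numFieldType) (hK : real_or_complex K)
    (E : completeNormedModType K) (e : nat -> E)
    (he : normalized_schauder_basis e) (hS : property_S' e) :
  exists phi : countable_ord -> countable_ord -> countable_ord,
    forall (X Y : completeNormedModType K) (A B : {linear X -> Y})
           (xi zeta : countable_ord),
      NP_class e A -> NP_class e B ->
      NP_index e A = Some (sval xi) ->
      NP_index e B = Some (sval zeta) ->
      xord_le (NP_index e (A \+ B)) (Some (sval (phi xi zeta))).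
Proof.
have bound (xi zeta : countable_ord) :=
  cid (NP_index_sum_bound hK he hS (proj2 (svalP xi)) (proj2 (svalP zeta))).
exists (fun xi zeta =>
  let: And3 a0 ca _ := projT2 (bound xi zeta) in
  exist _ (projT1 (bound xi zeta)) (conj a0 ca)).
move=> X Y A B xi zeta [bA _] [bB _] NA NB.
by case: (projT2 (bound xi zeta)) => a0 ca /= H; exact: H.
Qed.
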